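(* Let $(\Omega,\Sigma,\nu)$ be a complete probability space, let $X$ and $Y$ be Banach spaces and let $T:X\to Y$ be a semi-embedding. If $X$ is weakly Lindelöf determined (WLD) and $Y$ has the $\nu$-RNP, then $X$ has the $\nu$-RNP.
   Context: All Banach spaces are real. An operator is a continuous linear map. A semi-embedding is an injective operator $T:X\to Y$ such that $T(B_X)$ is norm closed in $Y$, where $B_X$ is the closed unit ball of $X$. $X$ is weakly Lindelöf determined (WLD) if $(B_{X^*},w^* )$ is a Corson compact, i.e. it is homeomorphic to a set $K\subseteq[-1,1]^I$ (for some non-empty set $I$), equipped with the product topology, such that $\{i\in I:k(i)\ne0\}$ is countable for every $k\in K$. A Banach space $Z$ has the $\nu$-Radon-Nikodým property ($\nu$-RNP) if for every countably additive vector measure $I:\Sigma\to Z$ of bounded variation with $I(A)=0$ whenever $\nu(A)=0$ there is a Bochner integrable function $g:\Omega\to Z$ such that $I(A)=\int_A g\,d\nu$ for all $A\in\Sigma$. *)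

(* Defs.v *)
From HB Require Import structures.
From mathcomp Require Import all_boot all_order all_algebra.
From mathcomp Require Import all_classical all_reals all_analysis.

Set Implicit Arguments.
Unset Strict Implicit.
Unset Printing Implicit Defensive.

Import Order.TTheory GRing.Theory Num.Theory.
Import numFieldNormedType.Exports.

Local Open Scope classical_set_scope.
Local Open Scope ring_scope.

Section SemiEmbedding.
Context {R : realType}.

Definition unit_ball (X : normedModType R) : set X := [set x | `|x| <= 1].
Arguments unit_ball : clear implicits.

Definition semi_embedding (X Y : normedModType R) (T : {linear X -> Y}) :=
  [/\ continuous T, injective T & closed (T @` unit_ball X)].

End SemiEmbedding.
Arguments unit_ball {R} X.

Definition homeomorphic (S T : topologicalType) :=
  exists (f : S -> T) (g : T -> S),
    [/\ cancel f g, cancel g f, continuous f & continuous g].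

Definition corson_compact (R : realType) (S : topologicalType) :=
  compact [set: S] /\
  exists (I : Type) (K : set {ptws I -> R}),
    [/\ inhabited I,
        forall k, K k -> forall i, -1 <= k i <= 1,
        forall k, K k -> countable [set i | k i != 0]
      & homeomorphic S (set_type K)].

Section WLD.
Context {R : realType}.

(* The ambient type carries the topology of pointwise convergence on X, so
   the subspace topology on the dual (and on its ball) is the w*-topology. *)
Definition continuous_dual (X : normedModType R) : set {ptws X -> R} :=
  [set f | scalar f /\ continuous (f : X -> R)].
Arguments continuous_dual : clear implicits.

Definition dual_ball (X : normedModType R) : set {ptws X -> R} :=
  continuous_dual X `&` [set f | forall x, unit_ball X x -> `|f x| <= 1].
Arguments dual_ball : clear implicits.

Definition WLD (X : normedModType R) :=
  corson_compact R (set_type (dual_ball X)).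

End WLD.
Arguments continuous_dual {R} X.
Arguments dual_ball {R} X.

Section Bochner.
Context {R : realType} {d : measure_display} {Omega : measurableType d}.
Variable nu : {measure set Omega -> \bar R}.
Context {Z : normedModType R}.
Implicit Types (A : set Omega) (s : nat -> Omega -> Z) (f g : Omega -> Z).

Definition simple_function f :=
  finite_set (range f) /\ forall z, measurable (f @^-1` [set z]).

Definition simple_integral A f : Z :=
  \sum_(z \in range f) fine (nu (A `&` f @^-1` [set z])) *: z.

Definition strongly_measurable g :=
  exists s, (forall n, simple_function (s n)) /\
    {ae nu, forall x, s n x @[n --> \oo] --> g x}.

Definition bochner_approximation g s :=
  (forall n, simple_function (s n)) /\
  (\int[nu]_x (`|s n x - g x|)%:E)%E @[n --> \oo] --> 0%E.

Definition bochner_integrable g :=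
  strongly_measurable g /\ exists s, bochner_approximation g s.

(* For Z complete, nu finite, A measurable and g Bochner integrable, the limit
   exists and does not depend on the approximation; otherwise the value is
   unspecified. *)
Definition bochner_integral A g : Z :=
  get [set v | exists s, bochner_approximation g s /\
    simple_integral A (s n) @[n --> \oo] --> v].

End Bochner.

Section VectorMeasure.
Context {R : realType} {d : measure_display} {Omega : measurableType d}.
Context {Z : normedModType R}.
Implicit Type m : set Omega -> Z.

(* A vector measure is a total function on sets; only its values on measurable
   sets matter. Additivity along constantly empty sequences gives m set0 = 0. *)
Definition countably_additive m :=
  forall F : nat -> set Omega, (forall n, measurable (F n)) ->
    trivIset setT F ->
    \sum_(0 <= i < n) m (F i) @[n --> \oo] --> m (\bigcup_n F n).

Definition vector_variation m (A : set Omega) : \bar R :=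
  ereal_sup [set v | exists (n : nat) (P : 'I_n -> set Omega),
    [/\ forall i, measurable (P i), trivIset setT P, \bigcup_i P i = A
      & v = (\sum_(i < n) `|m (P i)|)%:E]].

Definition of_bounded_variation m := (vector_variation m setT < +oo)%E.

End VectorMeasure.

Definition RNP {R : realType} {d : measure_display} {Omega : measurableType d}
    (nu : {measure set Omega -> \bar R}) (Z : normedModType R) :=
  forall m : set Omega -> Z,
    countably_additive m -> of_bounded_variation m ->
    (forall A, measurable A -> nu A = 0%E -> m A = 0) ->
    exists g : Omega -> Z, bochner_integrable nu g /\
      forall A, measurable A -> m A = bochner_integral nu A g.

(* Main.v *)
(** Let [m] be a vector measure in [X], let [g] be the density of [T m], and
    let [phi] be the density of the variation of [m].  On [{phi <= k}] the
    averages of [g] lie in the closed set [T (k B_X)], hence so does [g] almost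
    everywhere, and [f := T^-1 g] is defined almost everywhere and dominated by
    [phi + 1].  The sets [{|f - e| <= r}] are preimages under [g] of the closed
    images of balls, hence measurable; so [f] is Bochner integrable as soon as
    it is essentially separably valued, and then its integral is [m] because
    [T] is injective.

    Now [g] lies almost everywhere in a separable closed subspace [Y0], and the
    points of [X1 := T^-1 Y0] are separated by countably many functionals on
    [X].  As in the construction of projectional skeletons, close them off to
    countable sets [E] of [X] and [A] of the dual ball: [A] norms both [E] and
    the image of [E] in [X / X1], and [E] determines the coordinates, in the
    Corson embedding, that do not vanish identically on [A].  Then no nonzero
    element of the w*-closure of [A] vanishes on [E].  By w*-compactness and a
    finite-dimensional Hahn-Banach argument, each [x] in [X] agrees on [A] with
    a limit [x'] of points of [E]; if [x] is in [X1], so is [x'], hence [x = x']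
    and [X1] is separable. *)

Require Import Defs.
From HB Require Import structures.
From mathcomp Require Import all_boot all_order all_algebra.
From mathcomp Require Import all_classical all_reals all_analysis.
From mathcomp Require Import measurable_realfun zify ring lra.

Set Implicit Arguments.
Unset Strict Implicit.
Unset Printing Implicit Defensive.

Import Order.TTheory GRing.Theory Num.Theory.
Import numFieldNormedType.Exports.

Local Open Scope classical_set_scope.
Local Open Scope ring_scope.

(** * The Hahn-Banach theorem for seminorms *)

Section HahnBanach.
Context {R : realType} {V : lmodType R} (p : V -> R).
Hypothesis p_add : forall x y, p (x + y) <= p x + p y.
Hypothesis p_scale : forall (t : R) x, p (t *: x) = `|t| * p x.

(** Partial functionals are represented by their graphs, so that a chain has its union as upper
    bound. Single-valuedness follows from domination: two values at one point differ by at most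
    [p 0 = 0]. *)
Let dominated_graph (G : set (V * R)) :=
  (forall a u v, G u -> G v -> G (a *: u.1 + v.1, a * u.2 + v.2)) /\
  (forall u, G u -> u.2 <= p u.1).

(** A value [c] at [v] is admissible when it lies between all [u.2 - p (u.1 - v)] and all
    [p (w.1 + v) - w.2]. Subadditivity puts the former below the latter, and [c] is the supremum of
    the former. *)
Let graph_extend (G : set (V * R)) v : dominated_graph G -> G (0, 0) ->
  exists G', [/\ dominated_graph G', G `<=` G' & exists c, G' (v, c)].
Proof.
move=> [linG leG] G0.
pose S := [set u.2 - p (u.1 - v) | u in G].
have G_scale t u : G u -> G (t *: u.1, t * u.2).
  by move=> Gu; have := linG t _ _ Gu G0; rewrite !addr0.
have S_le u w : G u -> G w -> u.2 - p (u.1 - v) <= p (w.1 + v) - w.2.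
  move=> Gu Gw; have := leG _ (linG 1 _ _ Gu Gw); rewrite /= scale1r mul1r.
  have := p_add (u.1 - v) (w.1 + v).
  by rewrite addrACA (addrC (- v)) subrr addr0; lra.
have supS : has_sup S.
  split; first by exists (0 - p (0 - v)); exists (0, 0).
  by exists (p (0 + v) - 0) => _ [u Gu <-]; exact: (S_le u (0, 0)).
pose c := sup S.
have c_ge u : G u -> u.2 - p (u.1 - v) <= c.
  by move=> Gu; apply: ub_le_sup; [exact: supS.2|exists u].
have c_le w : G w -> c <= p (w.1 + v) - w.2.
  by move=> Gw; apply: ge_sup; [exact: supS.1|move=> _ [u Gu <-]; exact: S_le].
exists [set w | exists u t, G u /\ w = (u.1 + t *: v, u.2 + t * c)]; split.
- split=> [a _ _ [u [t [Gu ->]]] [w [s [Gw ->]]]|_ [u [t [Gu ->]]]] /=.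
    exists (a *: u.1 + w.1, a * u.2 + w.2), (a * t + s); split; first exact: linG.
    congr (_, _) => /=; last by ring.
    by rewrite scalerDr scalerDl scalerA addrACA.
  (* The sign of [t] decides which of the two bounds on [c] applies, to the point rescaled by the
     inverse of |t|. *)
  have [t0|t0|->] := ltgtP t 0; last by rewrite scale0r mul0r !addr0; exact: leG.
  + have Nt0 : 0 < - t by lra.
    have := c_ge _ (G_scale (- t)^-1 _ Gu) => /=.
    have -> : (- t)^-1 *: u.1 - v = (- t)^-1 *: (u.1 + t *: v).
      rewrite scalerDr scalerA invrN mulNr mulVf ?scaleN1r//; lra.
    rewrite p_scale gtr0_norm ?invr_gt0// -mulrBr ler_pdivrMl//; lra.
  + have := c_le _ (G_scale t^-1 _ Gu) => /=.
    have -> : t^-1 *: u.1 + v = t^-1 *: (u.1 + t *: v).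
      by rewrite scalerDr scalerA mulVf ?scale1r// gt_eqF.
    rewrite p_scale gtr0_norm ?invr_gt0// -mulrBr ler_pdivlMl//; lra.
- move=> u Gu; exists u, 0; split=> //.
  by rewrite scale0r mul0r !addr0 -surjective_pairing.
- by exists c, (0, 0), 1; split=> //; rewrite /= scale1r mul1r !add0r.
Qed.

Lemma hahn_banach_seminorm (x0 : V) :
  exists f : V -> R, [/\ scalar f, forall x, `|f x| <= p x & f x0 = p x0].
Proof.
have p0 : p 0 = 0 by rewrite -(scale0r 0) p_scale normr0 mul0r.
have p_ge0 x : 0 <= p x.
  have := p_add x (- x); rewrite subrr p0 -scaleN1r p_scale normrN1 mul1r; lra.
pose G0 := [set u : V * R | exists t : R, u = (t *: x0, t * p x0)].
(* Zorn's lemma runs over the sets whose union with the line [G0] is a dominated graph; this covers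
   the empty chain too. *)
have [F chainF|A [goodA maxA]] :=
  @Zorn_bigcup (V * R)%type (fun G => dominated_graph (G `|` G0)).
- move=> totF; split.
  + move=> a u v; case=> [[A FA Au]|[t ->]]; case=> [[B FB Bv]|[s ->]].
    * have [AB|BA] := totF _ _ FA FB.
        have [/(_ a u v)] := chainF _ FB; case;
          [by left; exact: AB|by left|by left; exists B|by right].
      have [/(_ a u v)] := chainF _ FA; case;
        [by left|by left; exact: BA|by left; exists A|by right].
    * have [/(_ a u (s *: x0, s * p x0))] := chainF _ FA; case;
        [by left|by right; exists s|by left; exists A|by right].
    * have [/(_ a (t *: x0, t * p x0) v)] := chainF _ FB; case;
        [by right; exists t|by left|by left; exists B|by right].
    * right; exists (a * t + s) => /=.
      by rewrite scalerDl scalerA mulrDl mulrA.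
  + move=> u [[A FA Au]|[t ->]]; first by have [_] := chainF _ FA; apply; left.
    by rewrite p_scale ler_wpM2r// ler_norm.
- set G := A `|` G0 in goodA.
  have [linG leG] := goodA.
  have G00 : G (0, 0) by right; exists 0; rewrite scale0r mul0r.
  have Gx0 : G (x0, p x0) by right; exists 1; rewrite scale1r mul1r.
  have totG v : exists c, G (v, c).
    have [G' [goodG' GG' [c G'c]]] := graph_extend v goodA G00.
    apply: contrapT => nG; apply: (maxA G').
      split; first by apply: subset_trans GG'; exact: subsetUl.
      by move=> G'A; apply: nG; exists c; left; exact: G'A.
    rewrite (_ : G' `|` G0 = G')//; apply/setUidPl.
    by apply: subset_trans GG'; exact: subsetUr.
  have funG v r s : G (v, r) -> G (v, s) -> r = s.
    have D a b : G (v, a) -> G (v, b) -> b <= a.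
      move=> Ga Gb; have := leG _ (linG (-1) _ _ Ga Gb).
      by rewrite /= scaleN1r addNr p0; lra.
    by move=> Gr Gs; apply/le_anti; rewrite !D.
  have [f Gf] := choice totG.
  exists f; split.
  + by move=> a x y; apply: funG (Gf _) _; exact: linG (Gf x) (Gf y).
  + move=> x; rewrite ler_norml (leG (_, _) (Gf x)) andbT.
    have := leG _ (linG (-1) _ _ (Gf x) G00).
    by rewrite /= !addr0 p_scale normrN1; lra.
  + exact: funG (Gf _) Gx0.
Qed.

End HahnBanach.

Lemma norming_functional (R : realType) (V : normedModType R) (x : V) :
  exists u : V -> R, [/\ scalar u, forall z, `|u z| <= `|z| & u x = `|x|].
Proof. exact: (hahn_banach_seminorm (@ler_normD _ V) (@normrZ _ V)). Qed.

(** * Countable closures and the w*-topology of the dual ball *)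

(** The closure consists of the values of finite terms, encoded as trees: a leaf is an index into an
    enumeration of [D], a node carries the code of an operation. Trees form a countable type;
    ill-formed ones get the default value [e 0]. *)
Lemma countable_closure (K : countType) (U : Type) (op : K -> U -> U -> U)
    (D : set U) : countable D ->
  exists C, [/\ countable C, D `<=` C &
    forall k u v, C u -> C v -> C (op k u v)].
Proof.
move=> /pfcard_geP[->|[e]]; first by exists set0; split=> //.
pose eval := fix eval (t : GenTree.tree nat) := match t with
  | GenTree.Leaf n => e n
  | GenTree.Node k (t1 :: t2 :: _) =>
      if choice.unpickle k is Some k' then op k' (eval t1) (eval t2) else e 0%N
  | _ => e 0%N
  end.
exists (range eval); split.
- exact: (sub_countable (card_image_le _ _) (@countableP (GenTree.tree nat) _)).
- move=> u Du; have [n _ <-] := @surj _ _ _ _ e _ Du.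
  by exists (GenTree.Leaf n).
- move=> k _ _ [t1 _ <-] [t2 _ <-].
  by exists (GenTree.Node (choice.pickle k) [:: t1; t2]); rewrite //= choice.pickleK.
Qed.

Lemma countable_enum (T : Type) (D : set T) : countable D -> D !=set0 ->
  exists e : nat -> T, (forall n, D (e n)) /\ D `<=` range e.
Proof.
move=> /pfcard_geP[->[]//|[e] _]; exists e; split=> [n|u Du]; first exact: funS.
by have [n _ <-] := @surj _ _ _ _ e _ Du; exists n.
Qed.

Lemma countable_setU (T : Type) (A B : set T) :
  countable A -> countable B -> countable (A `|` B).
Proof.
move=> cA cB; rewrite -bigcup2E; apply: bigcup_countable => // i _.
by rewrite /bigcup2; case: ifP => // _; case: ifP.
Qed.

Lemma ptws_eval_continuous (I : Type) (V : topologicalType) (i : I) :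
  continuous (fun f : {ptws I -> V} => f i).
Proof.
move=> f; have /cvg_sup/(_ i) fi : nbhs f --> (f : {ptws I -> V}) by apply: cvg_id.
exact: cvg_trans (cvg_app _ fi) (@initial_continuous _ _ _ f).
Qed.

Section ScalarFacts.
Context {R : pzRingType} {V : lmodType R} {a : V -> R}.
Hypothesis lin_a : scalar a.

Let f : {linear V -> R | *%R} :=
  HB.pack a (GRing.isLinear.Build _ _ _ _ a lin_a).

Lemma scalar0 : a 0 = 0. Proof. exact: (linear0 f). Qed.
Lemma scalarB x y : a (x - y) = a x - a y. Proof. exact: (linearB f). Qed.
Lemma scalarD x y : a (x + y) = a x + a y. Proof. exact: (linearD f). Qed.
Lemma scalarZ t x : a (t *: x) = t * a x.
Proof. by have := lin_a t x 0; rewrite scalar0 !addr0. Qed.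

End ScalarFacts.

Section DualBall.
Context {R : realType} {X : normedModType R}.

(** Homogeneity extends the bound from the unit ball to all of [X], and this bound in turn implies
    continuity. *)
Lemma dual_ballP (a : X -> R) :
  dual_ball X a <-> scalar a /\ forall x, `|a x| <= `|x|.
Proof.
split=> [[[lin_a _] le1]|[lin_a le_a]].
  split=> // x; have [->|x0] := eqVneq x 0; first by rewrite (scalar0 lin_a) !normr0.
  have := le1 (`|x|^-1 *: x); rewrite /unit_ball /= normrZ normfV normr_id.
  rewrite mulVf ?normr_eq0// lexx => /(_ erefl).
  by rewrite (scalarZ lin_a) normrM normfV normr_id ler_pdivrMl ?normr_gt0// mulr1.
split; last by move=> x /(le_trans (le_a x)).
split=> // x; apply/cvgrPdist_lt => e e0; near=> z.
rewrite -(scalarB lin_a) (le_lt_trans (le_a _))//.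
Unshelve. all: by end_near. Qed.

Local Notation S := (set_type (dual_ball X)).

Let nbhs_dual (a : S) : set_system S := fun U => exists (F : seq X) (e : R),
  0 < e /\ forall b : S, (forall x, x \in F -> `|\val b x - \val a x| < e) -> U b.

Let nbhs_dual_filter (a : S) : Filter (nbhs_dual a).
Proof.
split; first by exists [::], 1.
- move=> P Q [F [e [e0 FP]]] [G [f [f0 GQ]]].
  exists (F ++ G), (Num.min e f); split; first by rewrite lt_min e0.
  move=> b bFG; split; [apply: FP|apply: GQ] => x xF;
    have := bFG x; rewrite mem_cat xF ?orbT => /(_ erefl); rewrite lt_min => /andP[]//.
- by move=> P Q PQ [F [e [e0 FP]]]; exists F, e; split=> // b /FP/PQ.
Qed.

(** The basic sets given by finitely many points and a tolerance form a filter that converges to [a]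
    pointwise, hence in the subspace topology; so continuity can be tested on them. *)
Lemma dual_ball_continuousP (phi : S -> R) : continuous phi ->
  forall (a : S) (e : R), 0 < e -> exists (F : seq X) (d : R), 0 < d /\
    forall b : S, (forall x, x \in F -> `|\val b x - \val a x| < d) ->
      `|phi b - phi a| < e.
Proof.
move=> cphi a e e0.
have FF := nbhs_dual_filter a.
suff : nbhs_dual a --> a.
  move=> /(_ (fun b : S => `|phi b - phi a| < e)); apply.
  have /cvgrPdist_lt/(_ e e0) := cphi a.
  by apply: filterS => b; rewrite distrC.
move=> U; rewrite nbhsE => -[_ [[C oC <-] Ca] CU].
suff : (\val @ nbhs_dual a --> (\val a : {ptws X -> R})).
  by move=> H; apply: (@filterS _ _ FF _ _ CU); apply: H; exact: open_nbhs_nbhs.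
apply/pointwise_cvgP => x; apply/cvgrPdist_lt => r r0.
exists [:: x], r; split=> // b /(_ x); rewrite inE eqxx distrC; exact.
Qed.

(** Compactness yields a w*-cluster point [b]; the points [F] and the tolerance [e] describe a
    neighbourhood of [b], which meets every tail of the sequence. *)
Lemma dual_ball_cluster : compact [set: S] ->
  forall a : nat -> X -> R, (forall n, dual_ball X (a n)) ->
  exists b : X -> R, dual_ball X b /\ forall (F : seq X) (e : R) N, 0 < e ->
    exists n, (N <= n)%N /\ forall x, x \in F -> `|a n x - b x| < e.
Proof.
move=> cpt a Ba.
pose s n : S := SigSub (mem_set (Ba n)).
have [b [_ clb]] := cpt (s @ \oo) _ filterT.
exists (\val b); split; first exact: set_mem (valP b).
move=> F e N e0.
have nb : nbhs b [set c : S | forall x, x \in F -> `|\val c x - \val b x| < e].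
  elim: F => [|x F IH]; first by apply: filterS filterT.
  have : nbhs b [set c : S | `|\val c x - \val b x| < e].
    have cx : continuous (fun c : S => \val c x : R).
      move=> c; apply: (@continuous_comp _ _ _ (\val : S -> {ptws X -> R})
        (fun f : {ptws X -> R} => f x)).
        exact: initial_continuous.
      exact: ptws_eval_continuous.
    have /cvgrPdist_lt/(_ e e0) := cx b.
    by apply: filterS => c; rewrite distrC.
  apply: filterS2 IH => c cF cx y; rewrite inE => /predU1P[->//|]; exact: cF.
have sN : (s @ \oo) [set s n | n in [set n | (N <= n)%N]].
  by exists N => // n /= Nn; exists n.
have [_ [[n Nn <-] /= h]] := clb _ _ sN nb.
by exists n.
Qed.

(** The Corson embedding is turned into a map [h] on all functions, with value 0 outside the dual
    ball, so that its coordinates can be handled without subtypes. *)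
Lemma WLD_coordinates : WLD X ->
  compact [set: S] /\ exists (I : Type) (h : (X -> R) -> I -> R),
  [/\ forall a b : X -> R, dual_ball X a -> dual_ball X b -> h a = h b -> a = b,
      forall a : X -> R, dual_ball X a -> countable [set i | h a i != 0]
    & forall (a : X -> R) i (e : R), dual_ball X a -> 0 < e -> exists (F : seq X) (d : R),
        0 < d /\ forall b : X -> R, dual_ball X b ->
          (forall x, x \in F -> `|b x - a x| < d) -> `|h b i - h a i| < e].
Proof.
move=> [cpt [I [K [_ _ Kctbl [f [g [fK gK cf _]]]]]]]; split=> //.
pose h a : I -> R := match pselect (dual_ball X a) with
  | left Ba => \val (f (SigSub (mem_set Ba)))
  | right _ => fun=> 0 end.
have hE (a : S) : h (\val a) = \val (f a).
  rewrite /h; case: pselect => [Ba|/(_ (set_mem (valP a)))//].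
  by congr (\val (f _)); apply: val_inj.
have BS a : dual_ball X a -> exists s : S, \val s = a.
  by move=> Ba; exists (SigSub (mem_set Ba)).
exists I, h; split.
- move=> _ _ /BS[a <-] /BS[b <-]; rewrite !hE => /val_inj/(congr1 g).
  by rewrite !fK => ->.
- by move=> _ /BS[a <-]; rewrite hE; apply: Kctbl; exact: set_mem (valP (f a)).
- move=> _ i e /BS[a <-] e0.
  have ci : continuous (fun s : S => \val (f s) i : R).
    move=> c; apply: (@continuous_comp _ _ _ f
        (fun k : set_type K => (\val k : {ptws I -> R}) i)); first exact: cf.
    apply: (@continuous_comp _ _ _ (\val : set_type K -> {ptws I -> R})
        (fun f : {ptws I -> R} => f i)).
      exact: initial_continuous.
    exact: ptws_eval_continuous.
  have [F [d [d0 H]]] := dual_ball_continuousP ci a e0.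
  by exists F, d; split=> // _ /BS[b <-] /H; rewrite !hE.
Qed.

End DualBall.

(** * Separability of subspaces of weakly Lindelof determined spaces *)

Section DistanceToSet.
Context {R : realType} {X : normedModType R} (A : set X).
Hypothesis A0 : A !=set0.

Definition set_dist (x : X) : R := inf [set `|x - y| | y in A].

Let has_inf_dist x : has_inf [set `|x - y| | y in A].
Proof.
by case: A0 => y Ay; split; [exists `|x - y|, y|exists 0 => _ [z _ <-]].
Qed.

Lemma set_dist_ge0 x : 0 <= set_dist x.
Proof. by apply: lb_le_inf; [exact: (has_inf_dist x).1|move=> _ [y _ <-]]. Qed.

Lemma set_dist_le x y : A y -> set_dist x <= `|x - y|.
Proof. by move=> Ay; apply: ge_inf; [exact: (has_inf_dist x).2|exists y]. Qed.

Lemma set_dist_ltP x (e : R) : set_dist x < e -> exists2 y, A y & `|x - y| < e.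
Proof. by move=> /inf_lt -/(_ (has_inf_dist x).1)[_ [y Ay <-] ?]; exists y. Qed.

Lemma set_dist_lipschitz x y : set_dist x <= `|x - y| + set_dist y.
Proof.
apply/ler_addgt0Pr => e e0.
have [z Az yz] : exists2 z, A z & `|y - z| < set_dist y + e.
  by apply: set_dist_ltP; rewrite ltrDl.
by have := set_dist_le x Az; have := ler_distD y x z; lra.
Qed.

Lemma set_dist_eq0 x : closed A -> set_dist x = 0 -> A x.
Proof.
move=> cA dx; apply: cA => B /nbhs_ballP[e /= e0 xB].
have [y Ay xy] : exists2 y, A y & `|x - y| < e by apply: set_dist_ltP; rewrite dx.
by exists y; split=> //; apply: xB; rewrite -ball_normE.
Qed.

End DistanceToSet.

(** The distance to a subspace is the seminorm of the quotient by it; the Hahn-Banach theorem for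
    this seminorm provides functionals that vanish on the subspace. *)
Lemma set_dist_subspace_seminorm (R : realType) (X : normedModType R) (A : set X) :
  A 0 -> (forall (t : R) x y, A x -> A y -> A (t *: x + y)) ->
  (forall x y, set_dist A (x + y) <= set_dist A x + set_dist A y) /\
  (forall (t : R) x, set_dist A (t *: x) = `|t| * set_dist A x).
Proof.
move=> A0 linA; have nA : A !=set0 by exists 0.
have AZ (t : R) x : A x -> A (t *: x).
  by move=> Ax; have := linA t x 0 Ax A0; rewrite addr0.
split=> [x y|t x].
  apply/ler_addgt0Pr => e e0; have e20 : 0 < e / 2 by lra.
  have [x' Ax' xx'] : exists2 z, A z & `|x - z| < set_dist A x + e / 2.
    by apply: set_dist_ltP => //; rewrite ltrDl.
  have [y' Ay' yy'] : exists2 z, A z & `|y - z| < set_dist A y + e / 2.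
    by apply: set_dist_ltP => //; rewrite ltrDl.
  have := set_dist_le nA (x + y) (linA 1 _ _ Ax' Ay').
  have := ler_normD (x - x') (y - y').
  by rewrite scale1r opprD addrACA; lra.
(* This inequality, used also for [t^-1] and [t *: x], gives the equality. *)
have le s z : s != 0 -> set_dist A (s *: z) <= `|s| * set_dist A z.
  move=> s0; have s_gt0 : 0 < `|s| by rewrite normr_gt0.
  rewrite -ler_pdivrMl//; apply/ler_addgt0Pr => e e0.
  have [z' Az' zz'] : exists2 w, A w & `|z - w| < set_dist A z + e.
    by apply: set_dist_ltP => //; rewrite ltrDl.
  have := set_dist_le nA (s *: z) (AZ s _ Az').
  rewrite -scalerBr normrZ -ler_pdivrMl//; lra.
have [->|t0] := eqVneq t 0.
  rewrite scale0r normr0 mul0r; apply/le_anti.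
  by rewrite set_dist_ge0// (le_trans (set_dist_le nA 0 A0))// subrr normr0.
apply/le_anti; rewrite le//= -ler_pdivlMl ?normr_gt0// -normfV.
have := le t^-1 (t *: x); rewrite scalerA mulVf// scale1r; apply.
by rewrite invr_eq0.
Qed.

(** * Finite-dimensional separation over absolutely convex sets of functionals *)

Section AbsolutelyConvexFunctionals.
Context {R : realType} {X : normedModType R}.
Implicit Type C : set (X -> R).

(** The minus sign joins convexity and symmetry in one operation: [s = 0] gives the negative of
    [b]. *)
Definition abs_comb (s : R) (a b : X -> R) : X -> R :=
  fun x => s * a x - (1 - s) * b x.

Definition abs_convex C :=
  forall s a b, 0 <= s <= 1 -> C a -> C b -> C (abs_comb s a b).

Lemma abs_comb_dual_ball s a b : 0 <= s <= 1 ->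
  dual_ball X a -> dual_ball X b -> dual_ball X (abs_comb s a b).
Proof.
move=> /andP[s0 s1] /dual_ballP[la Ba] /dual_ballP[lb Bb]; apply/dual_ballP.
rewrite /abs_comb; split=> [t x y|x]; first by rewrite la lb; ring.
have := ler_normB (s * a x) ((1 - s) * b x).
rewrite !normrM (ger0_norm s0) (@ger0_norm _ (1 - s)) ?subr_ge0//.
have := ler_wpM2l s0 (Ba x); have := ler_wpM2l (_ : 0 <= 1 - s) (Bb x).
by rewrite subr_ge0 => /(_ s1); lra.
Qed.

Lemma dual_ball0 : dual_ball X (fun=> 0).
Proof. by apply/dual_ballP; split=> [t x y|x]; rewrite ?normr0// mulr0 addr0. Qed.

(* The one-dimensional Hahn-Banach step: the constraints on [c] coming from [a]
   and [b] are compatible because the combination of [a] and [b] vanishing at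
   [z] lies in [C]. *)
Lemma abs_convex_kernel1 C x z (e : R) : abs_convex C ->
  (forall a, C a -> a z = 0 -> `|a x| <= e) ->
  exists c, forall a, C a -> `|a x - c * a z| <= e.
Proof.
move=> convC kerC.
have CN a : C a -> C (fun y => - a y).
  move=> Ca; have := convC 0 a a _ Ca Ca; rewrite lexx ler01 => /(_ erefl).
  by congr C; apply/funext => y; rewrite /abs_comb; ring.
have compat a b : C a -> C b -> 0 < a z -> 0 < b z ->
    (a x - e) / a z <= (b x + e) / b z.
  move=> Ca Cb az bz.
  have ab : 0 < a z + b z by lra.
  have abn : a z + b z != 0 by rewrite gt_eqF.
  pose s := b z / (a z + b z).
  have s01 : 0 <= s <= 1.
    rewrite /s; apply/andP; split; first by apply: divr_ge0; lra.
    by rewrite ler_pdivrMr//; lra.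
  have := kerC _ (convC _ _ _ s01 Ca Cb).
  have -> : abs_comb s a b z = 0 by rewrite /abs_comb /s; field.
  move=> /(_ erefl).
  have -> : abs_comb s a b x = (b z * a x - a z * b x) / (a z + b z).
    by rewrite /abs_comb /s; field.
  rewrite ler_norml => /andP[_]; rewrite ler_pdivrMr// => h.
  by rewrite ler_pdivrMr// mulrAC ler_pdivlMr//; lra.
pose L := [set (a x - e) / a z | a in [set a | C a /\ 0 < a z]].
(* If no functional in [C] is positive at [z], then by symmetry all of them vanish there and [c = 0]
   will do. Otherwise [c] is the supremum of the lower bounds [L]. *)
have [L0|/set0P[l0 Ll0]] := eqVneq L set0.
  exists 0 => a Ca; rewrite mul0r subr0; apply: kerC => //.
  have nL b : C b -> b z <= 0.
    move=> Cb; rewrite leNgt; apply/negP => bz.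
    by have : L ((b x - e) / b z); [exists b|rewrite L0].
  by have := nL _ Ca; have := nL _ (CN _ Ca); lra.
have [b0 [Cb0 b0z] _] := Ll0.
have supL : has_sup L.
  split; first by exists l0.
  by exists ((b0 x + e) / b0 z) => _ [a [Ca az] <-]; exact: compat.
have main a : C a -> 0 < a z -> `|a x - sup L * a z| <= e.
  move=> Ca az; rewrite ler_norml; apply/andP; split.
    have : sup L <= (a x + e) / a z.
      by apply: ge_sup; [exists l0|move=> _ [b [Cb bz] <-]; exact: compat].
    by rewrite ler_pdivlMr//; lra.
  have : (a x - e) / a z <= sup L by apply: ub_le_sup; [exact: supL.2|exists a].
  by rewrite ler_pdivrMr//; lra.
exists (sup L) => a Ca; have [az|az|az] := ltgtP (a z) 0.
- have := main _ (CN _ Ca); rewrite oppr_gt0 => /(_ az).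
  by rewrite mulrN opprK addrC distrC.
- exact: main.
- by rewrite az mulr0 subr0; exact: kerC.
Qed.

(** Rational coefficients allow [E] to be countable, while its closure is still a real subspace. *)
Definition rat_subspace (E : set X) :=
  E 0 /\ forall (q : rat) x y, E x -> E y -> E (ratr q *: x + y).

(** Induction on [zs]: the hypothesis for the functionals vanishing at the head [z] gives [y], and
    the one-dimensional step corrects [x - y] by a multiple of [z]. Rounding this multiple to a
    rational is why [e] grows to [e']. *)
Lemma abs_convex_kernel (E : set X) C (zs : seq X) x (e e' : R) :
  rat_subspace E -> abs_convex C -> C `<=` dual_ball X -> e < e' ->
  (forall z, z \in zs -> E z) ->
  (forall a, C a -> (forall z, z \in zs -> a z = 0) -> `|a x| <= e) ->
  exists2 y, E y & forall a, C a -> `|a (x - y)| <= e'.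
Proof.
move=> [E0 linE]; elim: zs C x e e' => [|z zs IH] C x e e' convC BC ee' Ezs kerC.
  exists 0 => // a Ca; rewrite subr0 (le_trans _ (ltW ee'))//.
  by apply: kerC => // z; rewrite in_nil.
have ee1 : e < (e + e') / 2 by lra.
have [||||y Ey yC] := IH [set a | C a /\ a z = 0] x e _ _ _ ee1.
- move=> s a b s01 [Ca az] [Cb bz]; split; first exact: convC.
  by rewrite /abs_comb az bz; ring.
- by move=> a [Ca _]; exact: BC.
- by move=> w wzs; apply: Ezs; rewrite inE wzs orbT.
- move=> a [Ca az] aw; apply: kerC => // w; rewrite inE => /predU1P[->//|].
  exact: aw.
have [|c cC] := @abs_convex_kernel1 C (x - y) z ((e + e') / 2) convC.
  by move=> a Ca az; exact: yC.
(* As |a z| <= |z| for [a] in the dual ball, replacing [c] by a rational this close costs at most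
   the remaining half of [e' - e]. *)
have d0 : 0 < (e' - e) / 2 / (`|z| + 1).
  by rewrite !divr_gt0 ?subr_gt0// ltr_wpDl.
have cd : c < c + (e' - e) / 2 / (`|z| + 1) by rewrite ltrDl.
have [q] := rat_in_itvoo cd; rewrite in_itv/= => /andP[cq qc].
exists (ratr q *: z + y); first by apply: linE => //; apply: Ezs; rewrite inE eqxx.
move=> a Ca; have /dual_ballP[la Ba] := BC _ Ca.
have -> : x - (ratr q *: z + y) = (x - y) - ratr q *: z.
  by rewrite opprD addrCA addrC.
rewrite (scalarB la) (scalarZ la).
have -> : a (x - y) - ratr q * a z = (a (x - y) - c * a z) - (ratr q - c) * a z.
  by ring.
rewrite (le_trans (ler_normB _ _))// normrM (@ger0_norm _ (ratr q - c))//; last by lra.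
have : (ratr q - c) * `|a z| <= (e' - e) / 2.
  apply: (@le_trans _ _ ((e' - e) / 2 / (`|z| + 1) * (`|z| + 1))); last first.
    by rewrite divfK// gt_eqF// ltr_wpDl.
  apply: ler_pM => //; [by rewrite subr_ge0 ltW|by lra|].
  by rewrite (le_trans (Ba z))// lerDl.
by have := cC _ Ca; lra.
Qed.

End AbsolutelyConvexFunctionals.

(** * The w*-closure of a set of functionals *)

Section PointwiseClosure.
Context {R : realType} {X : normedModType R}.
Implicit Type A : set (X -> R).

(* The w*-closure of [A] in the dual ball. *)
Definition ptws_closure A : set (X -> R) := [set a | dual_ball X a /\
  forall (F : seq X) (e : R), 0 < e ->
    exists2 a', A a' & forall x, x \in F -> `|a' x - a x| < e].

(** A real coefficient is approximated by a rational one in [0, 1]; the error stays small because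
    the functionals are bounded on the finite set [F]. *)
Lemma ptws_closure_abs_convex A : A `<=` dual_ball X ->
  (forall (q : rat) a b, 0 <= (ratr q : R) <= 1 -> A a -> A b ->
    A (abs_comb (ratr q) a b)) ->
  abs_convex (ptws_closure A).
Proof.
move=> BA convA s a b s01 [Ba clA_a] [Bb clA_b].
split=> [|F e e0]; first exact: abs_comb_dual_ball.
have e40 : 0 < e / 4 by lra.
have [a' Aa' aa'] := clA_a F _ e40; have [b' Ab' bb'] := clA_b F _ e40.
have [M M0 FM] : exists2 M : R, 0 < M & forall x, x \in F -> `|x| <= M.
  elim: F {clA_a clA_b aa' bb'} => [|x F [M M0 FM]]; first by exists 1.
  exists (`|x| + M); first by rewrite ltr_wpDl.
  move=> y; rewrite inE => /predU1P[->|/FM]; first by rewrite lerDl ltW.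
  by have := normr_ge0 x; lra.
(* The error in the coefficient contributes at most [d * (M + M) = e / 2], and the errors in the
   functionals at most [e / 4]. *)
pose d := e / 4 / M.
have d0 : 0 < d by rewrite /d !divr_gt0.
have /andP[s0 s1] := s01.
have [q [q0 q1 qs]] : exists q : rat, [/\ 0 <= (ratr q : R), (ratr q : R) <= 1 &
    `|ratr q - s| <= d].
  have : Num.max 0 (s - d) < Num.min 1 (s + d).
    by rewrite gt_max !lt_min; apply/andP; split; apply/andP; split; lra.
  move=> /rat_in_itvoo[q]; rewrite in_itv/= gt_max lt_min.
  move=> /andP[/andP[? ?] /andP[? ?]].
  by exists q; split; [lra|lra|rewrite ler_norml; lra].
exists (abs_comb (ratr q) a' b'); first by apply: convA => //; rewrite q0.
move=> x xF; rewrite /abs_comb.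
have -> : ratr q * a' x - (1 - ratr q) * b' x - (s * a x - (1 - s) * b x) =
    (ratr q - s) * (a' x + b' x) + (s * (a' x - a x) - (1 - s) * (b' x - b x)).
  by ring.
have h1 : `|(ratr q - s) * (a' x + b' x)| <= d * (M + M).
  rewrite normrM ler_pM//.
  have /dual_ballP[_ Ba'] := BA _ Aa'; have /dual_ballP[_ Bb'] := BA _ Ab'.
  rewrite (le_trans (ler_normD _ _))// lerD//.
    exact: le_trans (Ba' x) (FM _ xF).
  exact: le_trans (Bb' x) (FM _ xF).
have dM : d * (M + M) = e / 2 by rewrite /d; field; rewrite gt_eqF.
have h2 : `|s * (a' x - a x)| <= s * (e / 4).
  by rewrite normrM ger0_norm// ler_wpM2l// ltW// aa'.
have h3 : `|(1 - s) * (b' x - b x)| <= (1 - s) * (e / 4).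
  by rewrite normrM ger0_norm ?subr_ge0// ler_wpM2l ?subr_ge0// ltW// bb'.
apply: le_lt_trans (ler_normD _ _) _.
by have := ler_normB (s * (a' x - a x)) ((1 - s) * (b' x - b x)); lra.
Qed.

(** If no finite subset works, there are functionals in the closure that vanish at the first [n]
    points of an enumeration of [E] and exceed [e] at [x]. A cluster point of them lies in the
    closure and vanishes on [E], so it is 0, which contradicts the values at [x]. *)
Lemma ptws_closure_finite_kernel A (E : set X) (x : X) (e : R) :
  compact [set: set_type (dual_ball X)] -> countable E -> E !=set0 ->
  (forall a, ptws_closure A a -> (forall z, E z -> a z = 0) -> a = fun=> 0) ->
  0 < e -> exists2 zs : seq X, (forall z, z \in zs -> E z) &
    forall a, ptws_closure A a -> (forall z, z \in zs -> a z = 0) -> `|a x| <= e.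
Proof.
move=> cpt cE nE sepE e0; have [u [Eu uE]] := countable_enum cE nE.
apply: contrapT => H.
have /choice[a aP] n : exists a, [/\ ptws_closure A a,
    forall k, (k < n)%N -> a (u k) = 0 & e < `|a x|].
  apply: contrapT => nex; apply: H; exists (mkseq u n).
    by move=> _ /mapP[k _ ->].
  move=> a Aa az; rewrite leNgt; apply/negP => ea; apply: nex; exists a.
  by split=> // k kn; apply: az; apply: map_f; rewrite mem_iota.
have [b [Bb bP]] : exists b, dual_ball X b /\ forall (F : seq X) (r : R) N, 0 < r ->
    exists n, (N <= n)%N /\ forall y, y \in F -> `|a n y - b y| < r.
  by apply: dual_ball_cluster => // n; have [[]] := aP n.
have Ab : ptws_closure A b.
  split=> // F r r0; have r20 : 0 < r / 2 by lra.
  have [n [_ nF]] := bP F _ 0%N r20; have [[_ /(_ F _ r20)[a' Aa' a'F]] _ _] := aP n.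
  exists a' => // y yF.
  have := ler_distD (a n y) (a' y) (b y).
  by have := nF _ yF; have := a'F _ yF; lra.
have b0 : b = fun=> 0.
  apply: sepE => // z /uE[k _ <-].
  apply/eqP; rewrite -normr_le0; apply/ler_addgt0Pr => /= r r0.
  have [n [kn /(_ (u k))]] := bP [:: u k] _ k.+1 r0.
  have [_ -> // _] := aP n.
  by rewrite inE eqxx sub0r normrN add0r => /(_ erefl)/ltW.
have [n [_ /(_ x)]] := bP [:: x] _ 0%N e0.
have [_ _] := aP n.
by rewrite inE eqxx b0 subr0 => h /(_ erefl); lra.
Qed.

End PointwiseClosure.

(* The role of the closure conditions is that of an elementary submodel: [E]
   generates a subspace onto which the quotient by the annihilator of [A] is a
   norm-one projection mapping [X1] into itself. *)
Lemma WLD_countable_closure (R : realType) (X : normedModType R) (X1 : set X)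
    (D : set (X -> R)) : WLD X -> X1 0 ->
  (forall (t : R) x y, X1 x -> X1 y -> X1 (t *: x + y)) ->
  countable D -> D `<=` dual_ball X ->
  exists (E : set X) (A : set (X -> R)),
  [/\ [/\ countable E, rat_subspace E, D `<=` A & A `<=` dual_ball X],
      forall x, E x -> exists2 a, A a & a x = `|x|,
      forall x, E x ->
        exists2 a, A a & (forall y, X1 y -> a y = 0) /\ a x = set_dist X1 x,
      abs_convex (ptws_closure A)
    & forall a, ptws_closure A a -> (forall z, E z -> a z = 0) -> a = fun=> 0].
Proof.
move=> wldX X10 linX1 cD BD.
have [cpt [I [h [injh ctblh conth]]]] := WLD_coordinates wldX.
have nX1 : X1 !=set0 by exists 0.
have [p_add p_scale] := set_dist_subspace_seminorm X10 linX1.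
have /choice[N NP] x : exists a : X -> R, dual_ball X a /\ a x = `|x|.
  have [a [la ale ax]] := norming_functional x.
  by exists a; split=> //; apply/dual_ballP.
have /choice[V VP] x : exists a : X -> R,
    [/\ dual_ball X a, forall y, X1 y -> a y = 0 & a x = set_dist X1 x].
  have [a [la ale ax]] := hahn_banach_seminorm p_add p_scale x.
  exists a; split=> //.
    apply/dual_ballP; split=> // y; rewrite (le_trans (ale y))//.
    by have := set_dist_le nX1 y X10; rewrite subr0.
  move=> y X1y; apply/eqP; rewrite -normr_le0 (le_trans (ale y))//.
  by have := set_dist_le nX1 y X1y; rewrite subrr normr0.
have B0 := @dual_ball0 R X.
(* For [i] in the countable support of [h a], w*-continuity of the coordinate [i] at 0 provides
   finite sets [F (i, k)], one for each tolerance; a functional vanishing on all of them has the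
   same coordinate as 0. The sequence [e] covers all these sets. *)
have /choice[e eP] a : exists e : nat -> X, dual_ball X a ->
    forall b, dual_ball X b -> (forall n, b (e n) = 0) ->
    forall i, h a i != 0 -> h b i = h (fun=> 0) i.
  have [Ba|] := pselect (dual_ball X a); last by exists (fun=> 0).
  have /choice[F FP] (ik : I * nat) : exists F : seq X, forall b, dual_ball X b ->
      (forall x, x \in F -> b x = 0) ->
      `|h b ik.1 - h (fun=> 0) ik.1| < ik.2.+1%:R^-1.
    have [||F [d [d0 H]]] := conth (fun=> 0) ik.1 ik.2.+1%:R^-1 => //.
    exists F => b Bb bF; apply: H => // x /bF ->.
    by rewrite subrr normr0.
  pose S := [set 0] `|` \bigcup_(ik in [set i | h a i != 0] `*` [set: nat])
     [set x | x \in F ik].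
  have cS : countable S.
    rewrite /S; apply: countable_setU => //; apply: bigcup_countable.
      by apply: countableX => //; exact: ctblh.
    by move=> ik _; apply: finite_set_countable; exact: finite_seq.
  have [u [_ uS]] := countable_enum cS (ex_intro _ 0 (or_introl erefl)).
  exists u => _ b Bb bu i hi; apply/eqP; rewrite -subr_eq0 -normr_le0.
  apply/ler_addgt0Pr => /= r r0; rewrite add0r.
  have [k rk] : exists k : nat, k.+1%:R^-1 < r.
    by have [k] := ltr_add_invr r0; rewrite add0r; exists k.
  apply: le_trans (ltW rk); apply/ltW.
  apply: (FP (i, k)) => // x xF.
  have /uS[n _ <-] : S x by right; exists (i, k).
  exact: bu.
(* Points and functionals are closed off together, as pairs: under rational combinations of points,
   rational absolutely convex combinations of functionals, the choices [N] and [V], and the points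
   [e]. Rationals outside [0, 1] leave the functional unchanged, so that it stays in the dual
   ball. *)
pose K := (rat + rat + bool + nat)%type.
pose op (k : K) (u v : X * (X -> R)) : X * (X -> R) := match k with
  | inl (inl (inl q)) => (ratr q *: u.1 + v.1, u.2)
  | inl (inl (inr q)) => (u.1,
      if 0 <= (ratr q : R) <= 1 then abs_comb (ratr q) u.2 v.2 else u.2)
  | inl (inr c) => (u.1, if c then N u.1 else V u.1)
  | inr n => (e u.2 n, u.2)
  end.
pose D0 := (fun a => (0 : X, a)) @` ([set fun=> 0] `|` D).
have cD0 : countable D0.
  by apply: sub_countable (card_image_le _ _) _; exact: countable_setU.
have [G [cG D0G opG]] := countable_closure op cD0.
pose G' := [set u | G u /\ dual_ball X u.2].
have opG' k u v : G' u -> G' v -> G' (op k u v).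
  move=> [Gu Bu] [Gv Bv]; split; first exact: opG.
  case: k => [[[q|q]|[]]|n] //=; [|by have [] := NP u.1|by have [] := VP u.1].
  by case: ifP => // ?; exact: abs_comb_dual_ball.
have G'0 : G' (0, fun=> 0) by split=> //; apply: D0G; exists (fun=> 0) => //; left.
pose E := fst @` G'; pose A := snd @` G'.
have BA : A `<=` dual_ball X by move=> _ [u [_ Bu] <-].
exists E, A; split.
- split=> //.
  + apply: sub_countable (card_image_le _ _) _.
    by apply: sub_countable cG; apply: subset_card_le => u [].
  + split; first by exists (0, fun=> 0).
    move=> q _ _ [u Gu <-] [v Gv <-].
    by exists (op (inl (inl (inl q))) u v) => //; exact: opG'.
  + move=> a Da; exists (0, a) => //; split; last exact: BD.
    by apply: D0G; exists a => //; right.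
- move=> _ [u Gu <-]; exists (N u.1); last by have [] := NP u.1.
  by exists (op (inl (inr true)) u u) => //; exact: opG'.
- move=> _ [u Gu <-]; exists (V u.1); last by have [] := VP u.1.
  by exists (op (inl (inr false)) u u) => //; exact: opG'.
- apply: ptws_closure_abs_convex => // q _ _ q01 [u Gu <-] [v Gv <-].
  by exists (op (inl (inl (inr q))) u v); [exact: opG'|rewrite /= q01].
- move=> a [Ba Aa] aE; apply: injh => //; apply/funext => i.
  (* A coordinate [i] that is nonzero at some member of [A] is determined by points of [E], on which
     [a] vanishes. Any other coordinate is zero on [A], hence also at [a], a w*-limit of members of
     [A]. *)
  have [[u Gu hu]|hA] := pselect (exists2 u, G' u & h u.2 i != 0).
    apply: (eP u.2) hu => //; first by have [] := Gu.
    move=> n; apply: aE; exists (op (inr n) u u) => //; exact: opG'.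
  have h0 u : G' u -> h u.2 i = 0.
    by move=> Gu; apply/eqP; apply: contrapT => /negP hu; apply: hA; exists u.
  rewrite (h0 _ G'0); apply/eqP; rewrite -normr_le0.
  apply/ler_addgt0Pr => /= r r0; rewrite add0r.
  have [F [d [d0 H]]] := conth a i r Ba r0.
  have [_ [u Gu <-] uF] := Aa F d d0.
  have := H u.2 (BA _ (ex_intro2 _ _ u Gu erefl)) uF.
  by rewrite (h0 _ Gu) sub0r normrN => /ltW.
Qed.

(** A point [x] of [X1] is approximated by points [y k] of [E], uniformly on [A]. As [A] norms
    differences of points of [E], the [y k] converge to some [x'], which agrees with [x] on [A]. As
    [A] also norms [E] modulo [X1], the limit is in [X1], where [D] tells points apart; so
    [x = x']. *)
Lemma WLD_separable_subspace (R : realType) (X : completeNormedModType R)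
    (X1 : set X) (D : set (X -> R)) : WLD X -> X1 0 ->
  (forall (t : R) x y, X1 x -> X1 y -> X1 (t *: x + y)) -> closed X1 ->
  countable D -> D `<=` dual_ball X ->
  (forall x, X1 x -> (forall a, D a -> a x = 0) -> x = 0) ->
  exists2 E : set X, countable E & X1 `<=` closure E.
Proof.
move=> wldX X10 linX1 clX1 cD BD sepD.
have [cpt _] := wldX; have nX1 : X1 !=set0 by exists 0.
have [E [A [[cE linE DA BA] normE distE convA kerE]]] :=
  WLD_countable_closure wldX X10 linX1 cD BD.
have AA : A `<=` ptws_closure A.
  move=> a Aa; split=> [|F e e0]; first exact: BA.
  by exists a => // x _; rewrite subrr normr0.
have nE : E !=set0 by exists 0; exact: linE.1.
have EB x y : E x -> E y -> E (x - y).
  move=> Ex Ey; have := linE.2 (-1) y x Ey Ex.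
  by rewrite rmorphN rmorph1 scaleN1r addrC.
exists E => // x X1x.
have /choice[y yP] (k : nat) : exists y, E y /\
    forall a, A a -> `|a (x - y)| <= k.+1%:R^-1.
  have k0 : 0 < k.+1%:R^-1 / 2 :> R by rewrite divr_gt0.
  have [zs Ezs zsP] := ptws_closure_finite_kernel x cpt cE nE kerE k0.
  have [||y Ey yP] := abs_convex_kernel linE convA _ _ Ezs zsP (e' := k.+1%:R^-1).
  - by move=> a [].
  - by rewrite gtr_pMr ?invr_gt0//; lra.
  - by exists y; split=> // a /AA; exact: yP.
have small (r : R) : 0 < r -> exists n, forall k, (n <= k)%N -> k.+1%:R^-1 < r.
  move=> r0; have [n] := ltr_add_invr r0; rewrite add0r => nr.
  exists n => k nk; apply: le_lt_trans nr.
  by rewrite lef_pV2 ?posrE// ler_nat ltnS.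
have ydist k l : `|y k - y l| <= k.+1%:R^-1 + l.+1%:R^-1.
  have [Ek Ak] := yP k; have [El Al] := yP l.
  have [a Aa <-] := normE _ (EB _ _ Ek El).
  have /dual_ballP[la _] := BA _ Aa.
  have -> : y k - y l = (x - y l) - (x - y k) by rewrite opprB [RHS]addrC addrA subrK.
  rewrite (scalarB la) (le_trans (ler_norm _))// (le_trans (ler_normB _ _))//.
  by rewrite addrC lerD ?Ak ?Al.
have [x' yx'] : exists x' : X, y n @[n --> \oo] --> x'.
  suff : cvgn y by exists (limn y).
  apply: cauchy_cvg; apply: cauchy_exP => r r0.
  have [n nP] := small (r / 2) ltac:(lra).
  exists (y n); exists n => // k /= nk; rewrite -ball_normE /=.
  by rewrite (le_lt_trans (ydist n k))// [r]splitr ltrD// nP.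
have near_x' (r : R) : 0 < r -> exists k, [/\ E (y k), `|x' - y k| < r &
    forall a, A a -> `|a (x - y k)| < r].
  move=> r0; have [n nP] := small r r0.
  have /cvgrPdist_lt/(_ r r0)[m _ mP] := yx'.
  exists (maxn m n); have [Ek Ak] := yP (maxn m n); split=> //.
    by apply: mP; exact: leq_maxl.
  move=> a /Ak /le_lt_trans; apply; apply: nP; exact: leq_maxr.
have X1x' : X1 x'.
  apply: set_dist_eq0 => //; apply/le_anti; rewrite set_dist_ge0// andbT.
  apply/ler_addgt0Pr => /= r r0.
  (* The functional that attains the distance of [y k] to [X1] vanishes at [x] and is small at
     [x - y k]; so this distance is small. *)
  have [k [Ek xk Ak]] := near_x' (r / 2) ltac:(lra).
  have [a Aa [aX1 ak]] := distE _ Ek; have /dual_ballP[la _] := BA _ Aa.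
  have := Ak _ Aa; rewrite (scalarB la) aX1// sub0r normrN => /(le_lt_trans (ler_norm _)).
  by rewrite ak; have := set_dist_lipschitz nX1 x' (y k); lra.
have -> : x = x'.
  apply/eqP; rewrite -subr_eq0; apply/eqP/sepD.
    by have := linX1 (-1) _ _ X1x' X1x; rewrite scaleN1r addrC.
  move=> a /DA Aa; apply/eqP; rewrite -normr_le0.
  apply/ler_addgt0Pr => /= r r0; rewrite add0r.
  have [k [Ek xk Ak]] := near_x' (r / 2) ltac:(lra).
  have /dual_ballP[la Ba] := BA _ Aa.
  have -> : x - x' = (x - y k) - (x' - y k) by rewrite opprB addrA subrK.
  rewrite (scalarB la) (le_trans (ler_normB _ _))//.
  by have := Ak _ Aa; have := Ba (x' - y k); lra.
move=> U /nbhs_ballP[r /= r0 rU]; have [k [Ek xk _]] := near_x' r r0.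
by exists (y k); split=> //; apply: rU; rewrite -ball_normE.
Qed.

(** * Bochner integrals *)

Section SimpleFunctions.
Context {R : realType} {d : measure_display} {Omega : measurableType d}.

Lemma simple_preimage (Z : normedModType R) (s : Omega -> Z) (B : set Z) :
  simple_function s -> measurable (s @^-1` B).
Proof.
move=> [fin_s ms].
rewrite (_ : s @^-1` B = \bigcup_(z in range s `&` B) s @^-1` [set z]).
  by apply: fin_bigcup_measurable => //; exact: finite_setIl.
apply/seteqP; split=> [x Bx|x [z [_ Bz] /= ->]//].
by exists (s x) => //; split=> //; exists x.
Qed.

Lemma simple_comp2 (Z W V : normedModType R) (phi : Z -> W -> V)
    (s : Omega -> Z) (t : Omega -> W) :
  simple_function s -> simple_function t ->
  simple_function (fun x => phi (s x) (t x)).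
Proof.
move=> Ss St; have [fin_s ms] := Ss; have [fin_t mt] := St; split=> [|v].
  apply: (sub_finite_set _ (finite_image2 phi fin_s fin_t)) => _ [x _ <-].
  by exists (s x); [exists x|exists (t x); [exists x|]].
rewrite (_ : _ @^-1` _ = \bigcup_(z in range s)
    (s @^-1` [set z] `&` t @^-1` [set w | phi z w = v])).
  apply: fin_bigcup_measurable => // z _.
  by apply: measurableI => //; exact: simple_preimage.
apply/seteqP; split=> [x xv|x [z _ [/= -> //]]].
by exists (s x) => //; exists x.
Qed.

Lemma simple_cst (Z : normedModType R) (z : Z) : simple_function (fun _ : Omega => z).
Proof.
split=> [|y]; first by apply: (sub_finite_set _ (finite_set1 z)) => _ [x _ <-].
have [->|yz] := eqVneq y z; first by rewrite (_ : _ @^-1` _ = setT)//; apply/seteqP.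
rewrite (_ : _ @^-1` _ = set0)//; apply/seteqP; split=> // x /= zy.
by rewrite zy eqxx in yz.
Qed.

Lemma measurable_simple_comp (Z : normedModType R) (s : Omega -> Z) (u : Z -> R) D :
  simple_function s -> measurable_fun D (u \o s).
Proof.
move=> Ss mD B _; apply: measurableI => //; rewrite comp_preimage.
exact: simple_preimage.
Qed.

Lemma simple_bounded (Z : normedModType R) (s : Omega -> Z) : simple_function s ->
  exists M : R, forall x, `|s x| <= M.
Proof.
move=> [/finite_seqP[r rE] _].
suff [M rM] : exists M : R, forall z, z \in r -> `|z| <= M.
  by exists M => x; apply: rM; have : range s (s x); [by exists x|rewrite rE].
elim: r {rE} => [|z r [M rM]]; first by exists 0.
exists (Num.max `|z| M) => w; rewrite inE le_max => /predU1P[->|/rM ->].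
  by rewrite lexx.
by rewrite orbT.
Qed.

End SimpleFunctions.

Section BochnerIntegral.
Context {R : realType} {d : measure_display} {Omega : measurableType d}.
Variable nu : probability Omega R.
Hypothesis nu_complete : measure_is_complete nu.

(** By completeness every subset of the null set [N] is measurable, so the behaviour of [f] on [N]
    is irrelevant. *)
Lemma complete_ae_measurable (N : set Omega) (f : Omega -> R) :
  measurable N -> nu N = 0%E -> measurable_fun (~` N) f ->
  measurable_fun [set: Omega] f.
Proof.
move=> mN N0 mf; rewrite -(setvU N).
apply/measurable_funU => //; first exact: measurableC.
split=> // _ B _; apply: nu_complete; exists N; split=> //; exact: subIsetl.
Qed.

Section Estimates.
Context {Z : normedModType R}.
Implicit Types (A : set Omega) (s t g : Omega -> Z) (S : nat -> Omega -> Z).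

Lemma strongly_measurable_comp g (u : Z -> R) :
  strongly_measurable nu g -> continuous u ->
  measurable_fun [set: Omega] (u \o g).
Proof.
move=> [S [simS [N [mN N0 SN]]]] cu.
apply: (complete_ae_measurable mN N0).
apply: (@measurable_fun_cvg _ _ _ _ (fun n => u \o S n)).
  by move=> n; exact: measurable_simple_comp.
move=> x Nx.
have Sx : S n x @[n --> \oo] --> g x.
  by apply: contrapT => nSx; apply: Nx; exact: SN.
exact: cvg_comp Sx (cu (g x)).
Qed.

Lemma strongly_measurable_dist s g : simple_function s ->
  strongly_measurable nu g ->
  measurable_fun [set: Omega] (fun x => `|s x - g x|).
Proof.
move=> Ss [S [simS Sg]].
apply: (@strongly_measurable_comp (fun x => s x - g x) (@Num.norm _ Z)).
  exists (fun n x => s x - S n x); split.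
    by move=> n; exact: (@simple_comp2 _ _ _ _ _ _ (fun z w => z - w)).
  apply: filterS Sg => x Sgx.
  by apply: cvgB => //; exact: cvg_cst.
exact: norm_continuous.
Qed.

Lemma integrable_simple_comp A s (u : Z -> R) : measurable A ->
  simple_function s -> (forall z, `|u z| <= `|z|) ->
  nu.-integrable A (EFin \o (u \o s)).
Proof.
move=> mA Ss u_le; apply: measurable_bounded_integrable => //.
- by rewrite (le_lt_trans (probability_le1 _ mA))// ltry.
- exact: measurable_simple_comp.
- have [M sM] := simple_bounded Ss; exists M; split; first exact: num_real.
  by move=> y My x _ /=; rewrite (le_trans (u_le _))// (le_trans (sM x))// ltW.
Qed.

(** This links vector-valued sums to Lebesgue integrals: norm estimates are obtained by applying a
    norming functional. *)
Lemma simple_integral_scalar A s (u : Z -> R) : measurable A ->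
  simple_function s -> scalar u ->
  (\int[nu]_(x in A) (u (s x))%:E = (u (simple_integral nu A s))%:E)%E.
Proof.
move=> mA Ss lin_u; have [/finite_seqP[r0 r0E] ms] := Ss.
pose r := undup r0; have ur : uniq r by exact: undup_uniq.
have rE : range s = [set` r].
  by rewrite r0E; apply/seteqP; split=> z /=; rewrite mem_undup.
rewrite /simple_integral rE -fsbig_seq//.
have -> : u (\sum_(z <- r) fine (nu (A `&` s @^-1` [set z])) *: z) =
    \sum_(z <- r) fine (nu (A `&` s @^-1` [set z])) * u z.
  elim: (r) => [|z q IH]; first by rewrite !big_nil (scalar0 lin_u).
  by rewrite !big_cons (scalarD lin_u) (scalarZ lin_u) IH.
have us x : u (s x) = \sum_(z <- r) u z * \1_(s @^-1` [set z]) x.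
  have xr : s x \in r by have : range s (s x); [by exists x|rewrite rE].
  rewrite (bigD1_seq (s x))//= indicE mem_set// mulr1 big1_seq ?addr0//.
  move=> z /andP[zsx _]; rewrite indicE memNset ?mulr0// => /= sxz.
  by rewrite sxz eqxx in zsx.
under eq_integral do rewrite us -sumEFin.
have int1 z : nu.-integrable A (fun x => (\1_(s @^-1` [set z]) x)%:E).
  apply: (@integrableS _ _ _ _ setT) => //; exact: integrable_indic.
rewrite integral_sum//; last first.
  by move=> z; under eq_fun do rewrite EFinM; exact: integrableZl.
rewrite -sumEFin; apply: eq_bigr => z _.
under eq_integral do rewrite EFinM.
rewrite integralZl// integral_indic// setIC muleC EFinM fineK//.
by apply: fin_num_measure; exact: measurableI.
Qed.

Lemma simple_integral_dist A s t : measurable A ->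
  simple_function s -> simple_function t ->
  (`|simple_integral nu A s - simple_integral nu A t|%:E <=
   \int[nu]_(x in A) `|s x - t x|%:E)%E.
Proof.
move=> mA Ss St.
set w := _ - _; have [u [lin_u u_le <-]] := norming_functional w.
rewrite (scalarB lin_u) EFinB -!simple_integral_scalar//.
have int_u q : simple_function q -> nu.-integrable A (EFin \o (fun x => u (q x))).
  by move=> Sq; exact: integrable_simple_comp.
rewrite -integralB_EFin//; [|exact: int_u|exact: int_u].
have Sst : simple_function (fun x => s x - t x).
  exact: (@simple_comp2 _ _ _ _ _ _ (fun z w => z - w)).
apply: le_integral => //.
- under eq_fun do rewrite -EFinB -(scalarB lin_u); exact: int_u Sst.
- apply: (integrable_simple_comp (u := @Num.norm _ Z) mA Sst) => z.
  by rewrite normr_id.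
- move=> x _; rewrite -EFinB lee_fin -(scalarB lin_u).
  exact: le_trans (ler_norm _) (u_le _).
Qed.

Lemma bochner_approximation_small g S : bochner_approximation nu g S ->
  forall e : R, 0 < e -> exists N, forall n, (N <= n)%N ->
    (\int[nu]_x `|S n x - g x|%:E < e%:E)%E.
Proof.
move=> [_ /fine_cvgP[[N1 _ fin_int] /cvgrPdist_lt lim0]] e e0.
have [N2 _ int_lt] := lim0 e e0.
exists (maxn N1 N2) => n; rewrite geq_max => /andP[N1n N2n].
rewrite -(fineK (fin_int _ N1n)) lte_fin.
have := int_lt _ N2n; rewrite /= sub0r normrN; apply: le_lt_trans.
exact: ler_norm.
Qed.

Lemma simple_integral_approx A g s t : measurable A ->
  strongly_measurable nu g -> simple_function s -> simple_function t ->
  (`|simple_integral nu A s - simple_integral nu A t|%:E <=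
   \int[nu]_(x in A) `|s x - g x|%:E + \int[nu]_(x in A) `|t x - g x|%:E)%E.
Proof.
move=> mA mg Ss St; apply: le_trans (simple_integral_dist mA Ss St) _.
have md q : simple_function q -> measurable_fun A (fun x => `|q x - g x|%:E).
  move=> Sq; apply/measurable_EFinP; apply: measurable_funTS.
  exact: strongly_measurable_dist.
rewrite -ge0_integralD//; [|exact: md|exact: md].
apply: ge0_le_integral => //.
- apply/measurable_EFinP; apply: (@measurable_simple_comp _ _ _ _
    (fun x => s x - t x) (@Num.norm _ Z)).
  exact: (@simple_comp2 _ _ _ _ _ _ (fun z w => z - w)).
- by apply: emeasurable_funD; exact: md.
- move=> x _; rewrite -EFinD lee_fin [`|t x - _|]distrC; exact: ler_distD.
Qed.

Lemma integral_dist_subset A s g : measurable A ->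
  strongly_measurable nu g -> simple_function s ->
  (\int[nu]_(x in A) `|s x - g x|%:E <= \int[nu]_x `|s x - g x|%:E)%E.
Proof.
move=> mA mg Ss; apply: ge0_subset_integral => //.
by apply/measurable_EFinP; exact: strongly_measurable_dist.
Qed.

Lemma bochner_approximation_close A g S S' (e : R) : measurable A ->
  strongly_measurable nu g ->
  bochner_approximation nu g S -> bochner_approximation nu g S' -> 0 < e ->
  exists N, forall n m, (N <= n)%N -> (N <= m)%N ->
    `|simple_integral nu A (S n) - simple_integral nu A (S' m)| < e.
Proof.
move=> mA mg apS apS' e0; have e20 : 0 < e / 2 by lra.
have [N1 N1P] := bochner_approximation_small apS e20.
have [N2 N2P] := bochner_approximation_small apS' e20.
exists (maxn N1 N2) => n m; rewrite !geq_max => /andP[n1 _] /andP[_ m2].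
rewrite -lte_fin (splitr e) EFinD.
apply: le_lt_trans (simple_integral_approx mA mg (apS.1 n) (apS'.1 m)) _.
apply: lteD; [exact: le_lt_trans (integral_dist_subset mA mg (apS.1 n)) (N1P _ n1)|].
exact: le_lt_trans (integral_dist_subset mA mg (apS'.1 m)) (N2P _ m2).
Qed.

(** The integrals along two approximations of [g] get arbitrarily close, so the set from which [get]
    chooses has one element. *)
Lemma bochner_integral_unique A g S (v : Z) : measurable A ->
  strongly_measurable nu g -> bochner_approximation nu g S ->
  simple_integral nu A (S n) @[n --> \oo] --> v ->
  bochner_integral nu A g = v.
Proof.
move=> mA mg apS Sv; apply: get_unique; first by exists S.
move=> v' [S' [apS' S'v']].
apply/eqP; rewrite -subr_eq0 -normr_le0; apply/ler_addgt0Pr => e e0; rewrite add0r.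
have e30 : 0 < e / 3 by lra.
have [N SS'] := bochner_approximation_close mA mg apS apS' e30.
have /cvgrPdist_lt/(_ _ e30)[N1 _ Sv1] := Sv.
have /cvgrPdist_lt/(_ _ e30)[N2 _ Sv2] := S'v'.
pose n := maxn N (maxn N1 N2).
have := SS' n n (leq_maxl _ _) (leq_maxl _ _).
have := Sv2 n; have := Sv1 n; rewrite /= /n !leq_max !leqnn !orbT.
move=> /(_ erefl) + /(_ erefl).
set a := simple_integral nu A _; set b := simple_integral nu A _ => va v'b ab.
have := ler_distD b v' v; have := ler_distD a b v.
by rewrite (distrC a v) (distrC b a); lra.
Qed.

End Estimates.

Section Complete.
Context {Z : completeNormedModType R}.
Implicit Types (A : set Omega) (s t g : Omega -> Z) (S : nat -> Omega -> Z).

Lemma bochner_integral_cvg A g S : measurable A ->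
  strongly_measurable nu g -> bochner_approximation nu g S ->
  simple_integral nu A (S n) @[n --> \oo] --> bochner_integral nu A g.
Proof.
move=> mA mg apS.
suff : cvgn (fun n => simple_integral nu A (S n)).
  move=> cS; have -> // := bochner_integral_unique mA mg apS cS.
apply: cauchy_cvg; apply: cauchy_exP => r r0.
have [N NP] := bochner_approximation_close mA mg apS apS r0.
exists (simple_integral nu A (S N)); exists N => // k /= Nk.
by rewrite -ball_normE /=; exact: NP.
Qed.

(** The approximations of [g] are compared with the constant simple function [z]. *)
Lemma bochner_integral_mean A g (z : Z) (r : R) : measurable A ->
  bochner_integrable nu g -> 0 <= r -> (forall x, A x -> `|g x - z| <= r) ->
  `|bochner_integral nu A g - fine (nu A) *: z| <= r * fine (nu A).
Proof.
move=> mA [mg [S apS]] r0 gr.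
have cstE : simple_integral nu A (fun=> z) = fine (nu A) *: z.
  (* A space of measure one is non-empty, so the constant function takes exactly the value [z]. *)
  have [ne _] : [set: Omega] !=set0.
    apply/set0P/eqP => T0; have := probability_setT nu; rewrite T0 measure0.
    by move=> /eqP; rewrite eq_sym onee_eq0.
  rewrite /simple_integral (_ : range _ = [set z]); last first.
    by apply/seteqP; split=> [_ [x _ <-]//|_ ->]; exists ne.
  rewrite fsbig_set1 (_ : _ @^-1` _ = setT) ?setIT//.
  by apply/seteqP.
have Scvg := bochner_integral_cvg mA mg apS.
apply/ler_addgt0Pr => e e0; have e20 : 0 < e / 2 by lra.
have [N1 N1P] := bochner_approximation_small apS e20.
have /cvgrPdist_lt/(_ _ e20)[N2 _ N2P] := Scvg.
pose n := maxn N1 N2.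
have h2 := N2P n (leq_maxr _ _); have h1 := N1P n (leq_maxl _ _).
have Sz := @simple_cst _ _ Omega _ z.
have nuA : (r * fine (nu A))%:E = (r%:E * nu A)%E.
  by rewrite EFinM fineK//; apply: fin_num_measure.
have h4 : (\int[nu]_(x in A) `|z - g x|%:E <= (r * fine (nu A))%:E)%E.
  rewrite nuA -integral_cst//; apply: ge0_le_integral => //.
    apply/measurable_EFinP; apply: measurable_funTS.
    exact: strongly_measurable_dist.
  by move=> x Ax; rewrite lee_fin distrC; exact: gr.
have h3 : `|simple_integral nu A (S n) - fine (nu A) *: z| < r * fine (nu A) + e / 2.
  rewrite -cstE -lte_fin (addrC (r * _)) EFinD.
  apply: le_lt_trans (simple_integral_approx mA mg (apS.1 n) Sz) _.
  apply: lte_leD (h4).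
    rewrite ge0_fin_numE; first exact: le_lt_trans h4 (ltry _).
    by apply: integral_ge0.
  exact: le_lt_trans (integral_dist_subset mA mg (apS.1 n)) h1.
have := ler_distD (simple_integral nu A (S n)) (bochner_integral nu A g)
  (fine (nu A) *: z).
by move: h2 => /=; lra.
Qed.

End Complete.
End BochnerIntegral.

(** * The variation of a vector measure *)

Section Variation.
Context {R : realType} {d : measure_display} {Omega : measurableType d}.
Context {Z : normedModType R} (m : set Omega -> Z).
Hypothesis m_add : countably_additive m.
Hypothesis m_bv : of_bounded_variation m.

Let subfamily (A : set Omega) (P : nat -> set Omega) :=
  [/\ forall i, measurable (P i), trivIset setT P & forall i, P i `<=` A].

(* Unlike [vector_variation], this is nonnegative and monotone also on
   non-measurable sets, as required of a measure. *)
Definition inner_variation (A : set Omega) : \bar R :=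
  ereal_sup [set v | exists (n : nat) (P : nat -> set Omega),
    subfamily A P /\ v = (\sum_(i < n) `|m (P i)|)%:E].

(** Consecutive partial sums along the constantly empty sequence differ by [m set0], and this
    difference tends to 0. *)
Lemma countably_additive_set0 : m set0 = 0.
Proof.
have m0cvg : \sum_(0 <= i < n) m set0 @[n --> \oo] --> m set0.
  have := m_add (fun=> measurable0) (@trivIset_set0 _ _ setT).
  by rewrite bigcup0.
have m0cvgS : \sum_(0 <= i < n.+1) m set0 @[n --> \oo] --> m set0.
  by move: m0cvg; rewrite -cvg_shiftS.
have : (\sum_(0 <= i < n.+1) m set0 - \sum_(0 <= i < n) m set0) @[n --> \oo]
    --> m set0 - m set0 by exact: cvgB.
rewrite subrr; under eq_fun do rewrite big_nat_recr//= addrAC subrr add0r.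
by move=> h; apply: (cvg_unique (@norm_hausdorff _ Z)) h; exact: cvg_cst.
Qed.

Let inner_variation_ub A n P : subfamily A P ->
  ((\sum_(i < n) `|m (P i)|)%:E <= inner_variation A)%E.
Proof. by move=> AP; apply: ereal_sup_ubound; exists n, P. Qed.

Lemma inner_variation_ge0 A : (0 <= inner_variation A)%E.
Proof.
have := @inner_variation_ub A 0%N (fun=> set0); rewrite big_ord0; apply.
by split=> // [|i]; [exact: trivIset_set0|exact: sub0set].
Qed.

Lemma le_inner_variation A B : A `<=` B ->
  (inner_variation A <= inner_variation B)%E.
Proof.
move=> AB; apply: ereal_sup_le => _ [n [P [[mP tP PA] ->]]].
by exists n, P; split=> //; split=> // i; exact: subset_trans (PA i) AB.
Qed.

Lemma inner_variation_norm A : measurable A ->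
  (`|m A|%:E <= inner_variation A)%E.
Proof.
move=> mA; have := @inner_variation_ub A 1%N (fun i => if i is 0%N then A else set0).
rewrite big_ord1; apply; split=> [[|i]//| |[|i]//].
by apply/trivIsetP => -[|i] [|j]//= _ _ _; rewrite ?set0I ?setI0.
Qed.

Lemma inner_variation_null (A : set Omega) :
  (forall B, measurable B -> B `<=` A -> m B = 0) -> inner_variation A = 0%E.
Proof.
move=> A0; apply/le_anti; rewrite inner_variation_ge0 andbT.
apply: ge_ereal_sup => _ [n [P [[mP tP PA] ->]]].
by rewrite lee_fin big1// => i _; rewrite A0// normr0.
Qed.

(** The complement of its union completes a finite disjoint family to a partition. *)
Lemma inner_variation_setT : (inner_variation setT < +oo)%E.
Proof.
apply: le_lt_trans m_bv; apply: ge_ereal_sup => _ [n [P [[mP tP _] ->]]].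
pose C := ~` \big[setU/set0]_(i < n) P i.
pose Q (i : 'I_n.+1) := if (i < n)%N then P i else C.
have PC i : (i < n)%N -> P i `&` C = set0.
  move=> ni; apply/seteqP; split=> // x [Pix]; apply.
  by rewrite -bigcup_mkord; exists i.
apply: (@le_trans _ _ (\sum_(i < n.+1) `|m (Q i)|)%:E).
  rewrite lee_fin big_ord_recr/= [leRHS]addrC ler_wpDl//.
  by apply: ler_sum => i _; rewrite /Q /= ltn_ord.
apply: ereal_sup_ubound; exists n.+1, Q; split=> //.
- move=> i; rewrite /Q; case: ifP => // _; apply: measurableC.
  exact: bigsetU_measurable.
- apply/trivIsetP => i j _ _ ij; rewrite /Q.
  case: ifPn => ni; case: ifPn => nj.
  + by move/trivIsetP : tP; apply.
  + exact: PC.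
  + by rewrite setIC; exact: PC.
  + exfalso; move/eqP: ij; apply; apply: val_inj => /=.
    by move: ni nj (ltn_ord i) (ltn_ord j); rewrite -!leqNgt !ltnS; lia.
- apply/seteqP; split=> // x _.
  have [[i /= ni Pix]|nx] := pselect ((\bigcup_(i < n) P i) x).
    by exists (widen_ord (leqnSn n) (Ordinal ni)) => //; rewrite /Q /= ni.
  by exists ord_max => //; rewrite /Q /= ltnn /C -bigcup_mkord.
Qed.

Lemma inner_variation_superadditive A B : A `&` B = set0 ->
  (inner_variation A + inner_variation B <= inner_variation (A `|` B))%E.
Proof.
move=> AB0.
have fin_B : inner_variation B \is a fin_num.
  rewrite ge0_fin_numE ?inner_variation_ge0//.
  by apply: le_lt_trans inner_variation_setT; exact: le_inner_variation.
rewrite -leeBrDr//; apply: ge_ereal_sup => _ [n [P [[mP tP PA] ->]]].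
rewrite leeBrDr// addeC -leeBrDr//.
apply: ge_ereal_sup => _ [k [Q [[mQ tQ QB] ->]]].
rewrite leeBrDr// -EFinD.
pose S i := if (i < n)%N then P i else Q (i - n)%N.
have -> : \sum_(i < k) `|m (Q i)| + \sum_(i < n) `|m (P i)| =
    \sum_(i < n + k) `|m (S i)|.
  rewrite big_split_ord addrC; congr (_ + _); apply: eq_bigr => i _.
    by rewrite /S /= ltn_ord.
  by rewrite /S /= ltnNge leq_addr/= addKn.
have PQ i j : P i `&` Q j = set0.
  by apply/seteqP; split=> // x [/PA Ax /QB Bx]; rewrite -AB0.
apply: inner_variation_ub; split.
- by move=> i; rewrite /S; case: ifP.
- apply/trivIsetP => i j _ _ ij; rewrite /S.
  case: ifPn => ni; case: ifPn => nj.
  + by move/trivIsetP : tP; apply.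
  + exact: PQ.
  + by rewrite setIC; exact: PQ.
  + move/trivIsetP : tQ; apply => //; move: ni nj ij; rewrite -!leqNgt; lia.
- move=> i; rewrite /S; case: ifP => _ x; first by move=> /PA; left.
  by move=> /QB; right.
Qed.

Lemma inner_variation_sigma_additive : semi_sigma_additive inner_variation.
Proof.
move=> F mF tF mUF.
have v0 := inner_variation_ge0.
suff -> : inner_variation (\bigcup_n F n) =
    (\sum_(0 <= i <oo) inner_variation (F i))%E.
  by apply: is_cvg_nneseries => i _ _; exact: v0.
apply/le_anti/andP; split; last first.
  apply: lime_le; first by apply: is_cvg_nneseries => i _ _; exact: v0.
  apply: nearW => n; rewrite big_mkord.
  suff : (\sum_(i < n) inner_variation (F i) <=
      inner_variation (\big[setU/set0]_(i < n) F i))%E.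
    move/le_trans; apply; apply: le_inner_variation.
    by rewrite -bigcup_mkord => x [i _ Fx]; exists i.
  elim: n => [|n IH]; first by rewrite !big_ord0; exact: v0.
  rewrite !big_ord_recr/=; apply: le_trans (leeD2r _ IH) _.
  apply: inner_variation_superadditive.
  apply/seteqP; split=> // x [+ Fnx]; rewrite -bigcup_mkord => -[i /= ni Fix].
  move/trivIsetP : tF => /(_ i n I I); rewrite ltn_eqF//.
  by move=> /(_ erefl)/seteqP[/(_ x) h _]; exact: h.
apply: ge_ereal_sup => _ [n [P [[mP tP PU] ->]]].
have series_ge i : (`|m (P i)|%:E <= \sum_(0 <= k <oo) `|m (P i `&` F k)|%:E)%E.
  have mcvg : \sum_(0 <= k < N) m (P i `&` F k) @[N --> \oo] --> m (P i).
    have := @m_add (fun k => P i `&` F k).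
    rewrite -setI_bigcupr (setIidl (PU i)); apply.
      by move=> k; exact: measurableI.
    exact: trivIset_setIl.
  have : `|\sum_(0 <= k < N) m (P i `&` F k)|%:E @[N --> \oo] --> `|m (P i)|%:E.
    apply: cvg_EFin; first exact: nearW.
    exact: cvg_norm.
  move=> /cvge_to_le; apply; apply: nearW => N.
  apply: (@le_trans _ _ (\sum_(0 <= k < N) `|m (P i `&` F k)|%:E)%E).
    by rewrite sumEFin lee_fin; exact: ler_norm_sum.
  by apply: nneseries_lim_ge => *; rewrite lee_fin.
apply: (@le_trans _ _ (\sum_(i < n) \sum_(0 <= k <oo) `|m (P i `&` F k)|%:E)%E).
  by rewrite -sumEFin; apply: lee_sum => i _; exact: series_ge.
rewrite -(@nneseries_sum _ _ _ _ (fun i k => `|m (P (i : 'I_n) `&` F k)|%:E))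
  => [|*]; last by rewrite lee_fin.
apply: lee_nneseries => k _ *.
  by apply: sume_ge0 => *; rewrite lee_fin.
rewrite sumEFin; apply: (@inner_variation_ub _ n (fun i => P i `&` F k)).
split=> [i| |i]; [exact: measurableI|exact: trivIset_setIr|exact: subIsetr].
Qed.

(** The variation is a finite measure, absolutely continuous with respect to [nu]; [phi] is its
    Radon-Nikodym density, made real-valued by [fine]. *)
Lemma variation_density (nu : probability Omega R) :
  (forall A, measurable A -> nu A = 0%E -> m A = 0) ->
  exists phi : Omega -> R, [/\ forall x, 0 <= phi x,
    nu.-integrable setT (EFin \o phi) &
    forall A, measurable A -> (`|m A|%:E <= \int[nu]_(x in A) (phi x)%:E)%E].
Proof.
move=> m_nu.
have v0 : inner_variation set0 = 0%E.
  apply: inner_variation_null => B _; rewrite subset0 => ->.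
  exact: countably_additive_set0.
have mixin1 := isMeasure.Build _ _ _ inner_variation v0 inner_variation_ge0
  inner_variation_sigma_additive.
pose mu1 : {measure set Omega -> \bar R} := HB.pack inner_variation mixin1.
have fin_v : fin_num_fun inner_variation.
  move=> A mA; rewrite ge0_fin_numE ?inner_variation_ge0//.
  by apply: le_lt_trans inner_variation_setT; exact: le_inner_variation.
have mixin2 := Measure_isFinite.Build _ _ _ mu1 fin_v.
pose mu : {finite_measure set Omega -> \bar R} := HB.pack inner_variation mu1 mixin2.
have mu_nu : mu `<< nu.
  move=> N nuN A mA AN; apply: inner_variation_null => B mB BA.
  by apply: m_nu => //; apply: nuN => //; exact: subset_trans AN.
have [f [f0 intf fE]] := radon_nikodym_finite mu_nu.
have aefin := integrable_ae measurableT intf.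
have aeE : ae_eq nu setT f (EFin \o fine \o f).
  by apply: filterS aefin => x /= fx _; rewrite fineK//; exact: fx.
have mfine : measurable_fun [set: Omega] (EFin \o (fine \o f)).
  by apply/measurable_EFinP; apply: measurableT_comp => //; exact: measurable_int intf.
exists (fine \o f); split=> [x| |A mA].
- exact: fine_ge0.
- apply/integrableP; split=> //; have /integrableP[_] := intf.
  apply: le_lt_trans; apply: ge0_le_integral => //.
  + by apply: measurableT_comp.
  + by apply: measurableT_comp => //; exact: measurable_int intf.
  + by move=> x _; rewrite /=; case: (f x) => [r| |] //=; rewrite normr0 leey.
- apply: le_trans (inner_variation_norm mA) _.
  rewrite (fE A mA : inner_variation A = _).
  rewrite (@ae_eq_integral _ _ _ _ _ (EFin \o (fine \o f)))//.
  + by apply: measurable_funTS; exact: measurable_int intf.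
  + by apply: measurable_funTS.
  + exact: ae_eq_subset (@subsetT _ A) aeE.
Qed.

End Variation.

(** * Almost sure range and Bochner integrability of vector-valued functions *)

Section BochnerCriteria.
Context {R : realType} {d : measure_display} {Omega : measurableType d}.
Variable nu : probability Omega R.
Hypothesis nu_complete : measure_is_complete nu.

Lemma measurable_sublevel (u : Omega -> R) (r : R) :
  measurable_fun [set: Omega] u -> measurable [set x | u x <= r].
Proof.
move=> mu; have := mu measurableT _ (measurable_itv `]-oo, r]).
by rewrite setTI (_ : _ @^-1` _ = [set x | u x <= r])//; apply/seteqP; split=> x /=;
  rewrite in_itv.
Qed.

Lemma set_dist_continuous (Z : normedModType R) (Q : set Z) :
  Q !=set0 -> continuous (set_dist Q).
Proof.
move=> nQ z; apply/cvgrPdist_lt => e e0.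
have /cvgrPdist_lt/(_ e e0) := @cvg_id _ (nbhs z).
apply: filterS => w; apply: le_lt_trans; rewrite ler_norml; apply/andP; split.
  by have := set_dist_lipschitz nQ w z; rewrite distrC; lra.
by have := set_dist_lipschitz nQ z w; lra.
Qed.

(** A closed set is the zero set of the distance to it, which is continuous. *)
Lemma measurable_preimage_closed (Z : normedModType R) (g : Omega -> Z)
    (Q : set Z) :
  strongly_measurable nu g -> Q !=set0 -> closed Q -> measurable (g @^-1` Q).
Proof.
move=> mg nQ cQ.
have mu := strongly_measurable_comp nu_complete mg (set_dist_continuous nQ).
have := measurable_sublevel 0 mu; congr measurable; apply/seteqP; split=> x /=.
  move=> dx; apply: set_dist_eq0 => //; apply/le_anti; rewrite dx/=.
  exact: set_dist_ge0.
by move=> Qx; have := set_dist_le nQ (g x) Qx; rewrite subrr normr0.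
Qed.

Lemma strongly_measurable_separable (Z : normedModType R) (g : Omega -> Z) :
  strongly_measurable nu g -> exists C : set Z, [/\ countable C, C !=set0 &
    {ae nu, forall x, closure C (g x)}].
Proof.
move=> [S [simS Sg]]; exists ([set 0] `|` \bigcup_n range (S n)); split.
- apply: countable_setU => //; apply: bigcup_countable => // n _.
  by apply: finite_set_countable; have [] := simS n.
- by exists 0; left.
- apply: filterS Sg => x Sx U /Sx[n _ nU].
  by exists (S n x); split; [right; exists n => //; exists x|apply: nU => /=].
Qed.

(** Almost all values of [g] outside [Q] lie in countably many balls whose radius is less than the
    distance of their centre to [Q]. The preimage of such a ball in [A] is null: otherwise the mean
    of [g] over it would lie in the ball and in [Q]. *)
Lemma bochner_mean_closed (Z : completeNormedModType R) (g : Omega -> Z)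
    (A : set Omega) (Q : set Z) :
  bochner_integrable nu g -> measurable A -> Q !=set0 -> closed Q ->
  (forall B, measurable B -> B `<=` A ->
    exists2 q, Q q & bochner_integral nu B g = fine (nu B) *: q) ->
  {ae nu, forall x, A x -> Q (g x)}.
Proof.
move=> ig mA nQ cQ meanQ; have [mg _] := ig.
have [C [cC nC aeC]] := strongly_measurable_separable mg.
have [e [_ Ce]] := countable_enum cC nC.
pose E n k := A `&` [set x | `|e n - g x| <= k.+1%:R^-1].
have mE n k : measurable (E n k).
  apply: measurableI => //; apply: measurable_sublevel.
  exact: (strongly_measurable_dist nu_complete (simple_cst (e n)) mg).
have E0 n k : k.+1%:R^-1 < set_dist Q (e n) -> nu (E n k) = 0%E.
  move=> kQ; have EA : E n k `<=` A by exact: subIsetl.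
  have [q Qq qE] := meanQ _ (mE n k) EA.
  have k0 : 0 <= k.+1%:R^-1 :> R by rewrite invr_ge0.
  have g_near x : E n k x -> `|g x - e n| <= k.+1%:R^-1.
    by move=> [_]; rewrite distrC.
  have := bochner_integral_mean nu_complete (mE n k) ig k0 g_near.
  rewrite qE -scalerBr normrZ.
  have nuE0 : 0 <= fine (nu (E n k)) by exact: fine_ge0.
  rewrite ger0_norm// mulrC => h.
  suff nuE : fine (nu (E n k)) = 0.
    by rewrite -[LHS]fineK ?nuE//; apply: fin_num_measure.
  have := set_dist_le nQ (e n) Qq; rewrite distrC => dq.
  apply/eqP; rewrite eq_le nuE0 andbT leNgt; apply/negP => nuE.
  move: h; rewrite ler_pM2r// => h.
  by have := lt_le_trans kQ (le_trans dq h); rewrite ltxx.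
have negl n k : nu.-negligible [set x | E n k x /\ k.+1%:R^-1 < set_dist Q (e n)].
  have [kQ|nkQ] := pselect (k.+1%:R^-1 < set_dist Q (e n)).
    by exists (E n k); split=> //; [exact: E0|move=> x []].
  by exists set0; split=> // x [].
have := negligible_bigcup (fun n => negligible_bigcup (negl n)).
move=> /(negligibleU aeC); apply: negligibleS => x /= nx.
apply: contrapT => /not_orP[/contrapT Cx nE]; apply: nx => Ax.
apply: contrapT => nQx.
have dx : 0 < set_dist Q (g x).
  rewrite lt_neqAle set_dist_ge0// andbT; apply/eqP => /esym.
  by move=> /(set_dist_eq0 nQ cQ).
(* Half the distance of [g x] bounds the radius, so that a centre within the radius of [g x] is
   itself farther than the radius from [Q]. *)
have dx2 : 0 < set_dist Q (g x) / 2 by lra.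
have [k] := ltr_add_invr dx2; rewrite add0r => kd.
have k0 : 0 < k.+1%:R^-1 :> R by rewrite invr_gt0.
have [c [Cc]] := Cx _ (nbhsx_ballx (g x) _ k0).
have [n _ <-] := Ce _ Cc; rewrite -ball_normE /= => gxe.
apply: nE; exists n => //; exists k => //; split.
  by split=> //=; rewrite distrC ltW.
by have := set_dist_lipschitz nQ (g x) (e n); move: kd gxe; set r := _^-1; lra.
Qed.

Lemma simple_if (Z : normedModType R) (b : Omega -> bool) (z : Z)
    (s : Omega -> Z) : measurable [set x | b x] -> simple_function s ->
  simple_function (fun x => if b x then z else s x).
Proof.
move=> mb Ss; have [fin_s ms] := Ss; split.
  apply: (@sub_finite_set _ _ ([set z] `|` range s)).
    by move=> _ [x _ <-]; case: ifP => _; [left|right; exists x].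
  by rewrite finite_setU.
move=> w; rewrite (_ : _ @^-1` _ = ([set x | b x] `&` (fun=> z) @^-1` [set w]) `|`
    (~` [set x | b x] `&` s @^-1` [set w])).
  apply: measurableU; apply: measurableI => //; last exact: measurableC.
  by have [_] := @simple_cst _ _ Omega _ z; apply.
apply/seteqP; split=> x /=; first by case: ifP => bx ?; [left|right].
by move=> [[-> //]|[/negP/negbTE ->]].
Qed.

(** [nearest n x] is a point closest to [f x] among the first [n.+1] points of [e]. As [e 0] is 0,
    its distance to [f x] is at most the norm of [f x], and dominated convergence applies. *)
Lemma bochner_integrable_dominated (Z : normedModType R) (f : Omega -> Z)
    (e : nat -> Z) (psi : Omega -> R) :
  e 0%N = 0 -> (forall n, measurable_fun [set: Omega] (fun x => `|f x - e n|)) ->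
  {ae nu, forall x, closure (range e) (f x)} ->
  nu.-integrable setT (EFin \o psi) -> (forall x, `|f x| <= psi x) ->
  bochner_integrable nu f.
Proof.
move=> e0 mf aef int_psi f_psi.
pose nearest := fix nearest n (x : Omega) : Z := if n is k.+1 then
  (if `|f x - e n| < `|f x - nearest k x| then e n else nearest k x) else e 0%N.
have nearestS k x : nearest k.+1 x =
  if `|f x - e k.+1| < `|f x - nearest k x| then e k.+1 else nearest k x by [].
have md n : measurable_fun [set: Omega] (fun x => `|f x - nearest n x|).
  elim: n => [|n IH]; first exact: mf.
  rewrite (_ : (fun x => _) = (fun x => `|f x - e n.+1|) \min
      (fun x => `|f x - nearest n x|)).
    exact: measurable_minr.
  by apply/funext => x; rewrite nearestS /= minEle; case: ltgtP.
have sim n : simple_function (nearest n).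
  elim: n => [|n IH]; first exact: simple_cst.
  apply: simple_if => //.
  have mtrue : measurable [set true] by [].
  have := measurable_fun_ltr (mf n.+1) (md n) measurableT mtrue.
  by rewrite setTI; congr measurable; apply/seteqP; split=> x /=.
have le_d n i x : (i <= n)%N -> `|f x - nearest n x| <= `|f x - e i|.
  elim: n => [|n IH]; first by rewrite leqn0 => /eqP ->.
  rewrite nearestS leq_eqVlt ltnS => /predU1P[->|/IH]; first by case: ltP.
  by case: ltP => // h /(le_trans (ltW h)).
have cvg_nearest x : closure (range e) (f x) -> nearest n x @[n --> \oo] --> f x.
  move=> clx; apply/cvgrPdist_lt => r r0.
  have [_ [[i _ <-]]] := clx _ (nbhsx_ballx (f x) _ r0).
  rewrite -ball_normE /= => fxe; exists i => // n /= ni.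
  exact: le_lt_trans (le_d _ _ _ ni) fxe.
split; first by exists nearest; split=> //; exact: filterS aef.
exists nearest; split=> //.
have [|||||_ _] := @dominated_convergence _ Omega R nu setT measurableT
  (fun n x => `|nearest n x - f x|%:E) (cst 0%E) (EFin \o psi).
- by move=> n; apply/measurable_EFinP; under eq_fun do rewrite distrC; exact: md.
- exact: measurable_cst.
- apply: filterS aef => x /cvg_nearest fx _.
  apply: cvg_EFin; first exact: nearW.
  rewrite (_ : _ \o _ = fun n => `|nearest n x - f x|)//.
  have -> : 0 = `|f x - f x| by rewrite subrr normr0.
  by apply: cvg_norm; apply: cvgB => //; exact: cvg_cst.
- exact: int_psi.
- apply: aeW => x n _; rewrite /= lee_fin normr_id distrC.
  by rewrite (le_trans (le_d n 0%N x _))// e0 subr0.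
by rewrite integral0.
Qed.

(** [T] may merge level sets of [s], so the sums are not compared termwise: a functional [u] norming
    the difference turns both sides into the integral of [u] composed with [T] and [s]. *)
Lemma simple_integral_linear (X Y : normedModType R) (T : {linear X -> Y}) A
    (s : Omega -> X) : measurable A -> simple_function s ->
  T (simple_integral nu A s) = simple_integral nu A (T \o s).
Proof.
move=> mA Ss; apply/eqP; rewrite -subr_eq0 -normr_eq0.
set w := _ - _; have [u [lin_u _ <-]] := norming_functional w.
have lin_uT : scalar (u \o T) by move=> a x y; rewrite /= linearP lin_u.
have STs : simple_function (T \o s).
  exact: (simple_comp2 (fun z (_ : X) => T z) Ss Ss).
rewrite (scalarB lin_u) subr_eq0; apply/eqP.
have := simple_integral_scalar nu mA STs lin_u.
by rewrite (simple_integral_scalar nu mA Ss lin_uT) => -[].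
Qed.

End BochnerCriteria.

(** * Semi-embeddings *)

Section Embedding.
Context {R : realType}.

(** For [r > 0], translation and scaling reduce the claim to the unit ball; for [r = 0] the image is
    a point. *)
Lemma semi_embedding_closed_ball (X Y : normedModType R) (T : {linear X -> Y})
    (e : X) (r : R) : semi_embedding T -> 0 <= r ->
  closed (T @` [set x | `|x - e| <= r]).
Proof.
move=> [_ _ cT]; rewrite le_eqVlt => /predU1P[<-|r0].
  rewrite (_ : T @` _ = [set T e]).
    by apply: accessible_closed_set1; apply: hausdorff_accessible; exact: norm_hausdorff.
  apply/seteqP; split=> [_ [x /= + <-]|_ ->]; last first.
    by exists e => //=; rewrite subrr normr0.
  by rewrite normr_le0 subr_eq0 => /eqP ->.
have rn0 : r != 0 by rewrite gt_eqF.
rewrite (_ : T @` _ = (fun y => r^-1 *: (y - T e)) @^-1` (T @` unit_ball X)).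
  apply: closed_comp => [y _|]; last exact: cT.
  by apply: cvgZl_tmp; apply: cvgB; [exact: cvg_id|exact: cvg_cst].
apply/seteqP; split=> [_ [x xe <-]|y [x xB xy]].
  exists (r^-1 *: (x - e)); last by rewrite linearZ linearB.
  by rewrite /unit_ball /= normrZ gtr0_norm ?invr_gt0// ler_pdivrMl// mulr1.
exists (e + r *: x).
  by rewrite /= addrC addKr normrZ gtr0_norm// ler_piMr// ltW.
by rewrite linearD linearZ /= xy scalerA mulfV// scale1r addrC subrK.
Qed.

Lemma continuous_linear_norm_le (X Y : normedModType R) (T : {linear X -> Y}) :
  continuous T -> exists2 K, 0 < K & forall x, `|T x| <= K * `|x|.
Proof.
move=> /linear_bounded_continuous/linear_boundedP/pinfty_ex_gt0[K K0 TK].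
by exists K.
Qed.

Lemma closure_distP (Z : normedModType R) (C : set Z) (z : Z) :
  closure C z <-> forall r, 0 < r -> exists2 c, C c & `|z - c| < r.
Proof.
split=> [clz r r0|zC U /nbhs_ballP[r /= r0 rU]].
  have [c [Cc]] := clz _ (nbhsx_ballx z _ r0).
  by rewrite -ball_normE; exists c.
by have [c Cc zc] := zC _ r0; exists c; split=> //; apply: rU; rewrite -ball_normE.
Qed.

Lemma countable_rat_span (Z : normedModType R) (C : set Z) : countable C ->
  exists E, [/\ countable E, C `<=` E & rat_subspace E].
Proof.
move=> cC.
have [E [cE CE opE]] := countable_closure
  (fun (q : rat) (x y : Z) => ratr q *: x + y) (countable_setU (countable1 0) cC).
exists E; split=> //; first by move=> x Cx; apply: CE; right.
by split=> //; apply: CE; left.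
Qed.

Lemma closure_rat_subspace (Z : normedModType R) (E : set Z) (t : R) x y :
  rat_subspace E -> closure E x -> closure E y -> closure E (t *: x + y).
Proof.
move=> [_ linE] /closure_distP clx /closure_distP cly; apply/closure_distP => r r0.
have r30 : 0 < r / 3 by lra.
have tq : t < t + r / 3 / (`|x| + 1) by rewrite ltrDl divr_gt0// ltr_wpDl.
have [q] := rat_in_itvoo tq; rewrite in_itv/= => /andP[q1 q2].
(* The rational [q] is fixed first, as the accuracy required of [c] depends on it. *)
have [c Ec xc] : exists2 c, E c & `|x - c| < r / 3 / (`|ratr q : R| + 1).
  by apply: clx; rewrite divr_gt0// ltr_wpDl.
have [c' Ec' yc'] := cly _ r30.
exists (ratr q *: c + c'); first exact: linE.
have -> : t *: x + y - (ratr q *: c + c') =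
    (t - ratr q) *: x + ratr q *: (x - c) + (y - c').
  by rewrite scalerBl scalerBr subrKA opprD [LHS]addrACA.
have h1 : `|(t - ratr q) *: x| <= r / 3.
  rewrite normrZ distrC gtr0_norm ?subr_gt0//.
  apply: (@le_trans _ _ (r / 3 / (`|x| + 1) * (`|x| + 1))); last first.
    by rewrite divfK// gt_eqF// ltr_wpDl.
  by apply: ler_pM => //; [lra|lra|rewrite lerDl].
have h2 : `|ratr q *: (x - c)| <= r / 3.
  rewrite normrZ mulrC.
  apply: (@le_trans _ _ (r / 3 / (`|ratr q : R| + 1) * (`|ratr q : R| + 1))); last first.
    by rewrite divfK// gt_eqF// ltr_wpDl.
  by apply: ler_pM => //; [exact: ltW|rewrite lerDl].
apply: le_lt_trans (ler_normD _ _) _.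
by have := ler_normD ((t - ratr q) *: x) (ratr q *: (x - c)); lra.
Qed.

(* The functionals norming a countable dense subset of the closure of [E],
   pulled back along [T], separate the points of the preimage of this closure. *)
Lemma WLD_preimage_separable (X : completeNormedModType R) (Y : normedModType R)
    (T : {linear X -> Y}) (E : set Y) :
  continuous T -> injective T -> WLD X -> countable E -> rat_subspace E ->
  exists2 F : set X, countable F & T @^-1` closure E `<=` closure F.
Proof.
move=> cT injT wldX cE ratE; have [E0 _] := ratE.
have [y [_ Ey]] := countable_enum cE (ex_intro _ 0 E0).
have [K K0 TK] := continuous_linear_norm_le cT.
have /choice[u uP] n : exists u : Y -> R,
    [/\ scalar u, forall z, `|u z| <= `|z| & u (y n) = `|y n|].
  exact: norming_functional.
(* The factor [K^-1] brings the functional into the dual ball. *)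
pose a n : X -> R := fun x => K^-1 * u n (T x).
apply: (@WLD_separable_subspace _ _ _ (range a)) => //.
- by rewrite /preimage /= linear0; exact: subset_closure.
- move=> t x x' Ex Ex'; rewrite /preimage /= linearP.
  exact: closure_rat_subspace.
- by apply: closed_comp => //; exact: closed_closure.
- exact: sub_countable (card_image_le _ _) _.
- move=> _ [n _ <-]; have [lin_u le_u _] := uP n; apply/dual_ballP; split.
    by move=> t x x'; rewrite /a linearP lin_u; ring.
  move=> x; rewrite normrM gtr0_norm ?invr_gt0// ler_pdivrMl//.
  exact: le_trans (le_u _) (TK x).
- move=> x Ex ax; apply: injT; rewrite linear0.
  apply/eqP; rewrite -normr_le0; apply/ler_addgt0Pr => r r0; rewrite add0r.
  have r20 : 0 < r / 2 by lra.
  have [c Ec] := (closure_distP _ _).1 Ex _ r20.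
  have [n _ <-] := Ey _ Ec; have [lin_u le_u un] := uP n => Txy.
  have ux : u n (T x) = 0.
    have /eqP := ax (a n) (ex_intro2 _ _ n I erefl).
    by rewrite mulf_eq0 invr_eq0 gt_eqF//= => /eqP.
  have := le_u (T x - y n); rewrite (scalarB lin_u) ux un sub0r normrN normr_id.
  by have := ler_distD (y n) (T x) 0; rewrite !subr0; lra.
Qed.

End Embedding.

(** * Transfer of the Radon-Nikodym property along a semi-embedding *)

Theorem corollary4p12 (R : realType) (d : measure_display)
    (Omega : measurableType d) (nu : probability Omega R)
    (X Y : completeNormedModType R) (T : {linear X -> Y}) :
  measure_is_complete nu -> semi_embedding T ->
  WLD X -> RNP nu Y -> RNP nu X.
Proof.
move=> nuC seT wldX rnpY m m_add m_bv m_nu.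
have [cT injT _] := seT.
have [K K0 TK] := continuous_linear_norm_le cT.
have [||A mA A0|g [ig gE]] := rnpY (T \o m).
- move=> F mF tF; have Fcvg := m_add F mF tF.
  have := cvg_comp _ _ Fcvg (cT (m (\bigcup_n F n))).
  by under [X in _ -> X @ _ --> _]eq_fun do rewrite /= -linear_sum.
- rewrite /of_bounded_variation.
  apply: (@le_lt_trans _ _ (K%:E * vector_variation m setT)%E).
    apply: ge_ereal_sup => _ [n [P [mP tP PT ->]]].
    apply: (@le_trans _ _ (K%:E * (\sum_(i < n) `|m (P i)|)%:E)%E).
      by rewrite -EFinM lee_fin mulr_sumr; apply: ler_sum => i _; exact: TK.
    rewrite lee_pmul2l// ?lte_fin//; apply: ereal_sup_ubound.
    by exists n, P.
  by rewrite lte_mul_pinfty// lee_fin ltW.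
- by rewrite /= m_nu// linear0.
have [phi [phi0 int_phi m_phi]] := variation_density m_add m_bv m_nu.
have mphi : measurable_fun [set: Omega] phi.
  by apply/measurable_EFinP; exact: measurable_int int_phi.
have [mg _] := ig.
(* Where [phi <= k.+1], the mean of [g] over a non-null set is the image under [T] of the mean of
   [m], whose norm is at most [k.+1]. On a null set [m] vanishes and [T 0] serves as the point of
   the image. *)
have g_ball k : {ae nu, forall x, phi x <= k.+1%:R ->
    exists2 z, T z = g x & `|z| <= k.+1%:R}.
  have k0 : 0 <= k.+1%:R :> R by [].
  have mk := measurable_sublevel k.+1%:R mphi.
  have := bochner_mean_closed nuC ig mk _
    (semi_embedding_closed_ball (e := 0) seT k0).
  have nQ : T @` [set z | `|z - 0| <= k.+1%:R] !=set0.
    by exists (T 0), 0 => //=; rewrite subrr normr0.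
  move=> /(_ nQ) H; apply: filterS (H _) => [x gx /gx[z /=]|B mB Bk].
    by rewrite subr0 => zk Tz; exists z.
  have finB : nu B \is a fin_num by apply: fin_num_measure.
  have nuB0 : 0 <= fine (nu B) by exact: fine_ge0.
  have mBk : `|m B| <= k.+1%:R * fine (nu B).
    rewrite -lee_fin EFinM fineK// -integral_cst//.
    apply: le_trans (m_phi B mB) _; apply: ge0_le_integral => //.
    - by move=> x _; rewrite lee_fin.
    - by apply/measurable_EFinP; exact: measurable_funTS.
  rewrite -gE//; have [nuB|nuB] := eqVneq (fine (nu B)) 0.
    exists (T 0); first by exists 0 => //=; rewrite subrr normr0.
    by move: mBk; rewrite nuB mulr0 normr_le0 scale0r /= => /eqP ->; rewrite linear0.
  have nuB1 : 0 < fine (nu B) by rewrite lt_neqAle eq_sym nuB.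
  exists (T ((fine (nu B))^-1 *: m B)); last by rewrite linearZ scalerA mulfV// scale1r.
  exists ((fine (nu B))^-1 *: m B) => //=.
  by rewrite subr0 normrZ gtr0_norm ?invr_gt0// ler_pdivrMl// mulrC.
have [C [cC _ aeC]] := strongly_measurable_separable mg.
have [E [cE CE ratE]] := countable_rat_span cC.
have [F cF EF] := WLD_preimage_separable cT injT wldX cE ratE.
(* With [k] the integral part of [phi x], almost every [g x] has a preimage of norm at most
   [k.+1 <= phi x + 1]. Elsewhere [f x] may be 0, so the bound holds everywhere. *)
pose inB x z := T z = g x /\ `|z| <= phi x + 1.
have /choice[f fP] x : exists z : X, `|z| <= phi x + 1 /\
    ((exists z, inB x z) -> T z = g x).
  have [[z [Tz zx]]|nz] := pselect (exists z, inB x z); first by exists z.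
  by exists 0; split=> //; rewrite normr0 addr_ge0.
have aef : {ae nu, forall x, T (f x) = g x}.
  have aeB : {ae nu, forall x, forall k : nat, phi x <= k.+1%:R ->
      exists2 z, T z = g x & `|z| <= k.+1%:R} by apply: ae_foralln.
  apply: filterS aeB => x gx.
  have [_] := fP x; apply.
  have /andP[t1 t2] := Num.Theory.truncn_itv (phi0 x).
  have [z Tz zx] := gx _ (ltW t2); exists z; split=> //.
  by rewrite (le_trans zx)// -natr1 lerD2r.
have [N [mN N0 fN]] := aef.
have fNE x : ~ N x -> T (f x) = g x.
  by move=> Nx; apply: contrapT => h; apply: Nx; exact: fN.
(* Off [N], injectivity of [T] identifies the points where [f] is within [r >= 0] of [e] with those
   where [g] lies in the closed image of a ball. For [r < 0] the superlevel set is everything off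
   [N]. *)
have mf e : measurable_fun [set: Omega] (fun x => `|f x - e|).
  apply: (complete_ae_measurable nuC mN N0).
  move=> mNC; apply: (measurability _ (RGenOInfty.measurableE R)) => // _ [_ [r ->] <-].
  have [r0|r0] := leP 0 r.
    rewrite [X in measurable X](_ : _ = ~` N `&`
        ~` (g @^-1` (T @` [set z | `|z - e| <= r]))).
      apply: measurableI; apply: measurableC => //.
      apply: (measurable_preimage_closed nuC mg).
        by exists (T e), e => //=; rewrite subrr normr0.
      exact: semi_embedding_closed_ball.
    apply/seteqP; split=> x [Nx /=]; rewrite in_itv/= andbT ltNge.
      move=> /negP fxe; split=> //= -[z ze]; rewrite -fNE// => /injT zf.
      by rewrite zf in ze.
    move=> nfe; split=> //; apply/negP => fxe.
    by apply: nfe; exists (f x) => //; exact: fNE.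
  rewrite [X in measurable X](_ : _ = ~` N); first exact: measurableC.
  apply/seteqP; split=> [x []//|x Nx]; split=> //=.
  by rewrite ?in_itv/= ?andbT (lt_le_trans r0).
have [e0 [e00 eF]] : exists e : nat -> X, e 0%N = 0 /\ F `<=` range e.
  have [u [_ uF]] := countable_enum (countable_setU (countable1 0) cF)
    (ex_intro _ 0 (or_introl erefl)).
  (* The shift makes 0 the first point, as the domination criterion demands. *)
  exists (fun n => if n is k.+1 then u k else 0); split=> // z Fz.
  by have [n _ <-] := uF z (or_intror Fz); exists n.+1.
have psi_int : nu.-integrable setT (EFin \o (fun x => phi x + 1)).
  rewrite (_ : _ \o _ = ((EFin \o phi) \+ (EFin \o cst 1%R))%E)//.
  apply: integrableD => //; exact: finite_measure_integrable_cst.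
have intf : bochner_integrable nu f.
  apply: (bochner_integrable_dominated e00 (fun n => mf (e0 n)) _ psi_int).
    apply: filterS2 aeC aef => x Cx fx; apply: closure_subset eF _ _.
    by apply: EF; rewrite /preimage /= fx; exact: closure_subset CE _ Cx.
  by move=> x; have [] := fP x.
have [smf [S' apS']] := intf.
(* As [T] is bounded by [K] and [T (f x) = g x] almost everywhere, [T] carries approximations of [f]
   to approximations of [g]. Hence [T] maps the integral of [f] over [A] to that of [g], which is
   [T (m A)]. *)
have apTS : bochner_approximation nu g (fun n => T \o S' n).
  have simTS n : simple_function (T \o S' n).
    exact: (simple_comp2 (fun z (_ : X) => T z) (apS'.1 n) (apS'.1 n)).
  split=> //.
  apply: (@squeeze_cvge _ _ _ _ (cst 0%E) _
    (fun n => K%:E * \int[nu]_x `|S' n x - f x|%:E)%E).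
  - apply: nearW => n; apply/andP; split; first exact: integral_ge0.
    have md := strongly_measurable_dist nuC (apS'.1 n) smf.
    rewrite -ge0_integralZl_EFin//; last 2 first.
      exact/measurable_EFinP.
      exact: ltW.
    apply: ae_ge0_le_integral => //.
    + exact/measurable_EFinP/(strongly_measurable_dist nuC (simTS n) mg).
    + by move=> x _; rewrite mule_ge0// lee_fin ltW.
    + by apply: measurable_funeM; exact/measurable_EFinP.
    + apply: filterS aef => x fx _.
      by rewrite -EFinM lee_fin -fx /= -linearB.
  - exact: cvg_cst.
  - rewrite -[X in _ --> X](mule0 K%:E); apply: cvgeZl => //.
    exact: apS'.2.
exists f; split=> // A mA.
have Scvg := bochner_integral_cvg nuC mA smf apS'.
apply: injT; have := gE A mA; rewrite /= => ->.
apply: (bochner_integral_unique nuC mA mg apTS).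
have := cvg_comp _ _ Scvg (cT (bochner_integral nu A f)).
apply: cvg_trans; apply: near_eq_cvg; apply: nearW => n.
by rewrite /= simple_integral_linear//; exact: apS'.1.
Qed.
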